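(* Let $p\colon X\to S$ be an inner fibration of simplicial sets, and let $u\colon x\to y$ be an edge of $X$. Then the following statements are equivalent: \begin{enumerate} \item $u$ is a $p$-cocartesian morphism of $X$; \item the induced map $X^{u/}\to X^{x/}\times_{S^{p(x)/}}S^{p(u)/}$ is a trivial Kan fibration. \end{enumerate}
   Context: For simplicial sets $A,B$ the wide join (fat join) $A\diamond B$ is the pushout of \[ A\sqcup B \leftarrow \partial\Delta^1\times A\times B \rightarrow \Delta^1\times A\times B, \] where the left map sends $\{0\}\times A\times B$ to $A$ and $\{1\}\times A\times B$ to $B$ by the projections, and the right map is the inclusion. For fixed $K$ the functor $K\diamond(-)$ from simplicial sets to simplicial sets under $K$ preserves colimits, hence has a right adjoint. The value of this right adjoint on a map $q\colon K\to Z$ is the wide slice $Z^{q/}$. Thus an $n$-simplex of $Z^{q/}$ is a map $K\diamond\Delta^n\to Z$ whose restriction to $K$ is $q$. An edge $u\colon x\to y$ of $X$ is regarded as a map $u\colon\Delta^1\to X$ with $u(0)=x$, and the vertex $x$ as a map $\Delta^0\to X$; so $X^{u/}$ and $X^{x/}$ are the wide slices of these maps, and similarly $S^{p(u)/}$ and $S^{p(x)/}$ are the wide slices of $p\circ u\colon\Delta^1\to S$ and $p(x)\colon\Delta^0\to S$. The induced map in (2) is given by restriction along $\{0\}\subset\Delta^1$ and by composition with $p$. A map of simplicial sets is an inner fibration if it has the right lifting property against the horn inclusions $\Lambda^n_k\subset\Delta^n$, $0<k<n$; it is a trivial Kan fibration if it has the right lifting property against all monomorphisms. An edge $u\colon\Delta^1\to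 X$ is $p$-cocartesian if, for every $n\ge 0$ and every commutative square consisting of maps $a\colon\Lambda^{n+2}_0\to X$ and $b\colon\Delta^{n+2}\to S$ with $p a=b|_{\Lambda^{n+2}_0}$ and $a|_{\Delta^{\{0,1\}}}=u$, there is a map $\Delta^{n+2}\to X$ extending $a$ and lifting $b$. *)

(* Defs.v *)
From HB Require Import structures.
From mathcomp Require Import all_boot all_order.
From mathcomp Require Import generic_quotient boolp.
From Stdlib Require Import Relation_Operators.

Set Implicit Arguments.
Unset Strict Implicit.
Unset Printing Implicit Defensive.

(** The object [[n]] of the simplex category is ['I_n.+1]; its morphisms are
    MathComp's order morphisms. Functional extensionality and proof irrelevance
    (from [boolp]) make Leibniz equality the right equality on order morphisms
    and on simplicial maps. *)

Definition shom (m n : nat) := {omorphism 'I_m.+1 -> 'I_n.+1}.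

Definition shom_id (n : nat) : shom n n := idfun.

Definition shom_comp (l m n : nat) (f : shom m n) (g : shom l m) : shom l n :=
  f \o g.

Lemma shom_eq (m n : nat) (f g : shom m n) : f =1 g -> f = g.
Proof.
case: f => f [[hf]]; case: g => g [[hg]] /= /funext efg.
by case: _ / efg hg => hg; rewrite (Prop_irrelevance hf hg).
Qed.

Record sset := SSet {
  simp :> nat -> Type;
  act : forall m n : nat, shom m n -> simp n -> simp m;
  act_id : forall (n : nat) (x : simp n), act (shom_id n) x = x;
  act_comp : forall (l m n : nat) (f : shom m n) (g : shom l m) (x : simp n),
    act (shom_comp f g) x = act g (act f x) }.
Arguments act [s m n].

Record smap (X Y : sset) := SMap {
  sfun :> forall n : nat, X n -> Y n;
  sfun_act : forall (m n : nat) (f : shom m n) (x : X n),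
    sfun (act f x) = act f (sfun x) }.
Arguments sfun [X Y] _ [n].

Lemma smap_eq (X Y : sset) (f g : smap X Y) :
  (forall n (x : X n), f n x = g n x) -> f = g.
Proof.
case: f => f hf; case: g => g hg /= efg.
have {}efg : f = g by apply: functional_extensionality_dep => n; apply/funext/efg.
by case: _ / efg hg => hg; rewrite (Prop_irrelevance hf hg).
Qed.

Lemma sig_eq (T : Type) (P : T -> Prop) (a b : {x | P x}) :
  proj1_sig a = proj1_sig b -> a = b.
Proof. by apply: eq_sig_hprop => x; apply: Prop_irrelevance. Qed.

Definition sid (X : sset) : smap X X :=
  @SMap X X (fun n x => x) (fun m n f x => erefl).

Definition scomp (X Y Z : sset) (g : smap Y Z) (f : smap X Y) : smap X Z.
Proof.
by exists (fun n x => g n (f n x)) => m n h x; rewrite !sfun_act.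
Defined.

Lemma scompA (X Y Z W : sset) (h : smap Z W) (g : smap Y Z) (f : smap X Y) :
  scomp h (scomp g f) = scomp (scomp h g) f.
Proof. exact: smap_eq. Qed.

Definition sprod (X Y : sset) : sset.
Proof.
exists (fun n => X n * Y n)%type (fun m n f z => (act f z.1, act f z.2)).
- by move=> n [x y]; rewrite /= !act_id.
- by move=> l m n f g [x y]; rewrite /= !act_comp.
Defined.

Definition sprod_map (X X' Y Y' : sset) (f : smap X X') (g : smap Y Y') :
  smap (sprod X Y) (sprod X' Y').
Proof.
exists (fun n (z : sprod X Y n) => (f n z.1, g n z.2) : sprod X' Y' n).
by move=> m n h [x y]; rewrite /= !sfun_act.
Defined.

Definition scoprod (X Y : sset) : sset.
Proof.
exists (fun n => X n + Y n)%type (fun m n f z =>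
  match z with inl x => inl (act f x) | inr y => inr (act f y) end).
- by move=> n [x|y]; rewrite act_id.
- by move=> l m n f g [x|y]; rewrite act_comp.
Defined.

Definition sinl (X Y : sset) : smap X (scoprod X Y).
Proof. by exists (fun n x => inl x : scoprod X Y n). Defined.

Definition sinr (X Y : sset) : smap Y (scoprod X Y).
Proof. by exists (fun n y => inr y : scoprod X Y n). Defined.

Definition scase (X Y Z : sset) (f : smap X Z) (g : smap Y Z) :
  smap (scoprod X Y) Z.
Proof.
exists (fun n (z : scoprod X Y n) =>
  match z with inl x => f n x | inr y => g n y end).
by move=> m n h [x|y]; rewrite /= sfun_act.
Defined.

Definition ssub (X : sset) (P : forall n, X n -> Prop)
  (hP : forall m n (f : shom m n) (x : X n), P n x -> P m (act f x)) : sset.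
Proof.
exists (fun n => {x : X n | P n x})
  (fun m n f x => exist (P m) (act f (proj1_sig x)) (hP m n f _ (proj2_sig x))).
- by move=> n [x hx]; apply: sig_eq; rewrite /= act_id.
- by move=> l m n f g [x hx]; apply: sig_eq; rewrite /= act_comp.
Defined.

Definition ssub_incl (X : sset) (P : forall n, X n -> Prop) hP :
  smap (@ssub X P hP) X.
Proof. by exists (fun n (x : ssub hP n) => proj1_sig x). Defined.

Definition ssub_corestr (X Y : sset) (P : forall n, X n -> Prop) hP
  (f : smap Y X) (hf : forall n (y : Y n), P n (f n y)) : smap Y (@ssub X P hP).
Proof.
exists (fun n y => exist (P n) (f n y) (hf n y) : ssub hP n).
by move=> m n h y; apply: sig_eq; rewrite /= sfun_act.
Defined.

Section Pullback.
Variables (X Y Z : sset) (f : smap X Z) (g : smap Y Z).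

Definition pullback_pred (n : nat) (z : sprod X Y n) : Prop :=
  f n z.1 = g n z.2.

Lemma pullback_closed (m n : nat) (h : shom m n) (z : sprod X Y n) :
  pullback_pred z -> pullback_pred (act h z).
Proof. by rewrite /pullback_pred /= !sfun_act => ->. Qed.

Definition spullback : sset := ssub pullback_closed.

Definition spullback_pair (W : sset) (a : smap W X) (b : smap W Y)
  (hab : scomp f a = scomp g b) : smap W spullback.
Proof.
exists (fun n w => exist (@pullback_pred n) (a n w, b n w)
  (congr1 (fun k : smap W Z => k n w) hab) : spullback n).
by move=> m n h w; apply: sig_eq; rewrite /= !sfun_act.
Defined.

End Pullback.

(* The pushout of [A <-f- C -g-> B]: at level [n], the quotient of [A n + B n] by
   the equivalence relation generated by [f c ~ g c]. *)
Section Pushout.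
Variables (A B C : sset) (f : smap C A) (g : smap C B).

Section Level.
Variable n : nat.

Inductive po_glue_rel : A n + B n -> A n + B n -> Prop :=
  PoGlue (c : C n) : po_glue_rel (inl (f n c)) (inr (g n c)).

Definition po_rel : rel {classic A n + B n} :=
  fun x y => `[< clos_refl_sym_trans _ po_glue_rel x y >].

Lemma po_rel_refl : reflexive po_rel.
Proof. by move=> x; apply/asboolP/rst_refl. Qed.

Lemma po_rel_sym : symmetric po_rel.
Proof. by move=> x y; apply/asboolP/asboolP; apply: rst_sym. Qed.

Lemma po_rel_trans : transitive po_rel.
Proof.
by move=> y x z /asboolP xy /asboolP yz; apply/asboolP; apply: rst_trans xy yz.
Qed.

Canonical po_equiv := EquivRel po_rel po_rel_refl po_rel_sym po_rel_trans.

Definition po_type : Type := {eq_quot po_equiv}%qT.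

Definition po_class (z : A n + B n) : po_type :=
  (\pi_({eq_quot po_equiv}) z)%qT.

Definition po_repr (z : po_type) : A n + B n :=
  (repr (z : {eq_quot po_equiv}))%qT.

Lemma po_reprK (z : po_type) : po_class (po_repr z) = z.
Proof. exact: reprK. Qed.

Lemma po_classP (x y : A n + B n) :
  po_class x = po_class y <-> clos_refl_sym_trans _ po_glue_rel x y.
Proof.
split=> [/eqP|h]; last by apply/eqquotP/asboolP.
by move/eqP/eqquotP => /asboolP.
Qed.

(* Descent of a compatible function to the quotient. *)
Lemma po_lift (T : Type) (h : A n + B n -> T) (z : A n + B n) :
  (forall c, h (inl (f n c)) = h (inr (g n c))) ->
  h (po_repr (po_class z)) = h z.
Proof.
move=> hc; have /po_classP := po_reprK (po_class z).
move: (po_repr _) => w; by elim=> [_ _ [c]|//|x y _ ->|x y t _ -> _ ->].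
Qed.

End Level.

Definition po_act (m n : nat) (h : shom m n) (z : po_type n) : po_type m :=
  po_class (act h (po_repr z : scoprod A B n)).

Lemma po_act_class (m n : nat) (h : shom m n) (z : scoprod A B n) :
  po_act h (po_class z) = po_class (act h z).
Proof.
apply: (po_lift (h := fun t : scoprod A B n => po_class (act h t))) => c.
by apply/po_classP/rst_step; rewrite /= -!sfun_act; constructor.
Qed.

Definition spushout : sset.
Proof.
exists po_type po_act.
- by move=> n z; rewrite -{1}[z]po_reprK po_act_class act_id po_reprK.
- move=> l m n h k z; rewrite -[z]po_reprK !po_act_class.
  by rewrite act_comp.
Defined.

Definition po_in : smap (scoprod A B) spushout.
Proof.
by exists (fun n z => po_class z : spushout n) => m n h z; rewrite /= po_act_class.
Defined.

Definition po_inl : smap A spushout := scomp po_in (sinl A B).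
Definition po_inr : smap B spushout := scomp po_in (sinr A B).

Lemma po_glue : scomp po_inl f = scomp po_inr g.
Proof. by apply: smap_eq => n c; apply/po_classP/rst_step; constructor. Qed.

Section Descent.
Variables (Z : sset) (a : smap A Z) (b : smap B Z).
Hypothesis hab : scomp a f = scomp b g.

Definition po_desc_fun (n : nat) (z : po_type n) : Z n :=
  scase a b n (po_repr z).

Lemma po_desc_class (n : nat) (z : scoprod A B n) :
  po_desc_fun (po_class z) = scase a b n z.
Proof.
apply: (@po_lift n (Z n) (fun t => scase a b n t)) => c.
exact: (congr1 (fun k : smap C Z => k n c) hab).
Qed.

Definition po_desc : smap spushout Z.
Proof.
exists (fun n (z : spushout n) => po_desc_fun z) => m n k z.
rewrite /= -[z]po_reprK po_act_class !po_desc_class.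
exact: sfun_act.
Defined.

Lemma po_desc_inl : scomp po_desc po_inl = a.
Proof. by apply: smap_eq => n x; apply: po_desc_class. Qed.

Lemma po_desc_inr : scomp po_desc po_inr = b.
Proof. by apply: smap_eq => n x; apply: po_desc_class. Qed.

End Descent.

Lemma po_ext (Z : sset) (h k : smap spushout Z) :
  scomp h po_inl = scomp k po_inl -> scomp h po_inr = scomp k po_inr -> h = k.
Proof.
move=> el er; apply: smap_eq => n z; rewrite -[z]po_reprK.
case: (po_repr z) => x.
- exact: (congr1 (fun t : smap A Z => t n x) el).
- exact: (congr1 (fun t : smap B Z => t n x) er).
Qed.

End Pushout.

Definition Delta (n : nat) : sset.
Proof.
exists (fun m => shom m n) (fun m m' f s => shom_comp s f).
- by move=> m x; apply: shom_eq.
- by move=> l m m' f g x; apply: shom_eq.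
Defined.

Definition Delta_map (m n : nat) (f : shom m n) : smap (Delta m) (Delta n).
Proof.
exists (fun k (s : Delta m k) => shom_comp f s : Delta n k).
by move=> k l h s; apply: shom_eq.
Defined.

Definition misses (n : nat) (j : 'I_n.+1) (m : nat) (s : Delta n m) : Prop :=
  forall i : 'I_m.+1, (s : shom m n) i <> j.

Definition boundary_pred (n m : nat) (s : Delta n m) : Prop :=
  exists j : 'I_n.+1, misses j s.

Lemma boundary_closed (n l m : nat) (f : shom l m) (s : Delta n m) :
  boundary_pred s -> boundary_pred (act f s).
Proof. by case=> j hj; exists j => i; apply: hj. Qed.

Definition boundary (n : nat) : sset := ssub (@boundary_closed n).

Definition boundary_incl (n : nat) : smap (boundary n) (Delta n) :=
  ssub_incl (@boundary_closed n).

Definition horn_pred (n : nat) (k : 'I_n.+1) (m : nat) (s : Delta n m) : Prop :=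
  exists2 j : 'I_n.+1, j != k & misses j s.

Lemma horn_closed (n : nat) (k : 'I_n.+1) (l m : nat) (f : shom l m)
  (s : Delta n m) : horn_pred k s -> horn_pred k (act f s).
Proof. by case=> j jk hj; exists j => // i; apply: hj. Qed.

Definition horn (n : nat) (k : 'I_n.+1) : sset := ssub (@horn_closed n k).

Definition horn_incl (n : nat) (k : 'I_n.+1) : smap (horn k) (Delta n) :=
  ssub_incl (@horn_closed n k).

Section Initial.
Variables (m n : nat) (hmn : m <= n).

Definition initial_fun : 'I_m.+1 -> 'I_n.+1 := @widen_ord m.+1 n.+1 hmn.

Lemma initial_fun_homo : {homo initial_fun : i j / (i <= j)%O}.
Proof. by move=> i j; rewrite !leEord. Qed.

HB.instance Definition _ :=
  Order.isOrderMorphism.Build _ _ _ _ initial_fun initial_fun_homo.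

(* The inclusion of [{0, ..., m}] into [[n]]. *)
Definition initial : shom m n := initial_fun.

End Initial.

(* The inclusion of the vertex [{0}] into [Delta 1]. *)
Definition vertex0 : smap (Delta 0) (Delta 1) := Delta_map (initial (leq0n 1)).

Definition vertex1_fun : 'I_1 -> 'I_2 := fun=> ord_max.

Lemma vertex1_fun_homo : {homo vertex1_fun : i j / (i <= j)%O}.
Proof. by []. Qed.

HB.instance Definition _ :=
  Order.isOrderMorphism.Build _ _ _ _ vertex1_fun vertex1_fun_homo.

Definition vertex1 : smap (Delta 0) (Delta 1) := Delta_map (vertex1_fun : shom 0 1).

Lemma horn_edge_subproof (n k : nat) (s : Delta 1 k) :
  horn_pred (ord0 : 'I_n.+3) (Delta_map (initial (isT : 1 <= n.+2)) k s).
Proof.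
exists ord_max => // i /(congr1 (@nat_of_ord _)) /= e.
by have := ltn_ord (s i); rewrite e.
Qed.

(* The inclusion of the edge [Delta^{0,1}] into the horn [Lambda^{n+2}_0]. *)
Definition horn_edge (n : nat) : smap (Delta 1) (horn (ord0 : 'I_n.+3)) :=
  ssub_corestr (@horn_closed n.+2 ord0) (@horn_edge_subproof n).

Section WideJoin.
Variables A B : sset.

Definition wjoin_cyl : sset := sprod (sprod (Delta 1) A) B.

Definition wjoin_ends : sset := sprod (sprod (boundary 1) A) B.

Definition wjoin_incl : smap wjoin_ends wjoin_cyl :=
  sprod_map (sprod_map (boundary_incl 1) (sid A)) (sid B).

(* A simplex of [boundary 1] is constant, with value its value at the vertex 0. *)
Lemma boundary1_act (m n : nat) (f : shom m n) (s : boundary 1 n) :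
  (proj1_sig (act f s) : shom m 1) ord0 = (proj1_sig s : shom n 1) ord0.
Proof.
case: s => s [j hj] /=; move: (hj (f ord0)) (hj ord0) => /eqP + /eqP.
by move: (s (f ord0)) (s ord0) j {hj} => [[|[|//]] ?] [[|[|//]] ?] [[|[|//]] ?];
  rewrite -!val_eqE //= => _ _; apply: val_inj.
Qed.

Definition wjoin_proj : smap wjoin_ends (scoprod A B).
Proof.
exists (fun n (z : wjoin_ends n) =>
  (if (proj1_sig z.1.1 : shom n 1) ord0 == ord0 then inl z.1.2 else inr z.2)
  : scoprod A B n).
move=> m n f [[s a] b]; have e := boundary1_act f s.
by rewrite /= in e *; rewrite e; case: ifP.
Defined.

Definition wjoin : sset := spushout wjoin_proj wjoin_incl.

Definition wjoin_l : smap A wjoin :=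
  scomp (po_inl wjoin_proj wjoin_incl) (sinl A B).

Definition wjoin_r : smap B wjoin :=
  scomp (po_inl wjoin_proj wjoin_incl) (sinr A B).

Definition wjoin_c : smap wjoin_cyl wjoin := po_inr wjoin_proj wjoin_incl.

Lemma wjoin_ext (Z : sset) (h k : smap wjoin Z) :
  scomp h wjoin_l = scomp k wjoin_l -> scomp h wjoin_r = scomp k wjoin_r ->
  scomp h wjoin_c = scomp k wjoin_c -> h = k.
Proof.
move=> el er ec; apply: po_ext ec; apply: smap_eq => n [x|x].
- exact: (congr1 (fun t : smap A Z => t n x) el).
- exact: (congr1 (fun t : smap B Z => t n x) er).
Qed.

End WideJoin.

Section WideJoinMap.
Variables (A A' B B' : sset) (f : smap A A') (g : smap B B').

Definition wjoin_cyl_map : smap (wjoin_cyl A B) (wjoin_cyl A' B') :=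
  sprod_map (sprod_map (sid (Delta 1)) f) g.

Lemma wjoin_map_subproof :
  scomp (scase (scomp (wjoin_l A' B') f) (scomp (wjoin_r A' B') g))
        (wjoin_proj A B) =
  scomp (scomp (wjoin_c A' B') wjoin_cyl_map) (wjoin_incl A B).
Proof.
apply: smap_eq => n [[s a] b].
have /(congr1 (fun k : smap (wjoin_ends A' B') (wjoin A' B') =>
  k n ((s, f n a), g n b))) := po_glue (wjoin_proj A' B') (wjoin_incl A' B').
by rewrite /=; case: ifP.
Qed.

Definition wjoin_map : smap (wjoin A B) (wjoin A' B') :=
  po_desc wjoin_map_subproof.

Lemma wjoin_map_l : scomp wjoin_map (wjoin_l A B) = scomp (wjoin_l A' B') f.
Proof.
apply: smap_eq => n x.
exact: (congr1 (fun k : smap (scoprod A B) _ => k n (inl x))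
  (po_desc_inl wjoin_map_subproof)).
Qed.

Lemma wjoin_map_r : scomp wjoin_map (wjoin_r A B) = scomp (wjoin_r A' B') g.
Proof.
apply: smap_eq => n x.
exact: (congr1 (fun k : smap (scoprod A B) _ => k n (inr x))
  (po_desc_inl wjoin_map_subproof)).
Qed.

Lemma wjoin_map_c :
  scomp wjoin_map (wjoin_c A B) = scomp (wjoin_c A' B') wjoin_cyl_map.
Proof. exact: po_desc_inr. Qed.

End WideJoinMap.

Lemma wjoin_map_id (A B : sset) : wjoin_map (sid A) (sid B) = sid (wjoin A B).
Proof.
by apply: wjoin_ext; rewrite ?(wjoin_map_l, wjoin_map_r, wjoin_map_c);
  apply: smap_eq => n // [[]].
Qed.

Lemma wjoin_map_comp (A A' A'' B B' B'' : sset) (f' : smap A' A'')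
  (f : smap A A') (g' : smap B' B'') (g : smap B B') :
  wjoin_map (scomp f' f) (scomp g' g) =
  scomp (wjoin_map f' g') (wjoin_map f g).
Proof.
apply: wjoin_ext; rewrite -[in RHS]scompA.
- by rewrite !wjoin_map_l [RHS](scompA _ _ f) wjoin_map_l -scompA.
- by rewrite !wjoin_map_r [RHS](scompA _ _ g) wjoin_map_r -scompA.
- by rewrite !wjoin_map_c [RHS](scompA _ _ (wjoin_cyl_map f g)) wjoin_map_c -scompA;
  congr (scomp _ _); apply: smap_eq.
Qed.

Section WideSlice.
Variables (K Z : sset) (q : smap K Z).

Definition wslice_simp (n : nat) : Type :=
  {h : smap (wjoin K (Delta n)) Z | scomp h (wjoin_l K (Delta n)) = q}.

Definition wslice_mk (n : nat) (h : smap (wjoin K (Delta n)) Z)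
  (e : scomp h (wjoin_l K (Delta n)) = q) : wslice_simp n :=
  exist (fun k => scomp k (wjoin_l K (Delta n)) = q) h e.

Lemma wslice_act_subproof (m n : nat) (f : shom m n) (h : wslice_simp n) :
  scomp (scomp (proj1_sig h) (wjoin_map (sid K) (Delta_map f)))
        (wjoin_l K (Delta m)) = q.
Proof.
by rewrite -scompA wjoin_map_l scompA (proj2_sig h); apply: smap_eq.
Qed.

Definition wslice : sset.
Proof.
exists wslice_simp (fun m n f h => wslice_mk (wslice_act_subproof f h)).
- move=> n h; apply: sig_eq => /=.
  have -> : Delta_map (shom_id n) = sid (Delta n).
    by apply: smap_eq => k s; apply: shom_eq.
  by rewrite wjoin_map_id; apply: smap_eq.
- move=> l m n f g h; apply: sig_eq => /=.
  rewrite -scompA -wjoin_map_comp; congr (scomp _ (wjoin_map _ _)).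
  by apply: smap_eq => k s; apply: shom_eq.
Defined.

End WideSlice.

Section WideSliceRestr.
Variables (K' K Z : sset) (i : smap K' K) (q : smap K Z) (q' : smap K' Z).
Hypothesis hq : scomp q i = q'.

Lemma wslice_restr_subproof (n : nat) (h : wslice q n) :
  scomp (scomp (proj1_sig h) (wjoin_map i (sid (Delta n))))
        (wjoin_l K' (Delta n)) = q'.
Proof. by rewrite -scompA wjoin_map_l scompA (proj2_sig h). Qed.

Definition wslice_restr : smap (wslice q) (wslice q').
Proof.
exists (fun n h => wslice_mk (wslice_restr_subproof h) : wslice q' n).
move=> m n f h; apply: sig_eq => /=.
rewrite -!scompA -!wjoin_map_comp.
by congr (scomp _ (wjoin_map _ _)); apply: smap_eq.
Defined.

End WideSliceRestr.

Section WideSlicePost.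
Variables (K Z Z' : sset) (p : smap Z Z') (q : smap K Z).

Lemma wslice_post_subproof (n : nat) (h : wslice q n) :
  scomp (scomp p (proj1_sig h)) (wjoin_l K (Delta n)) = scomp p q.
Proof. by rewrite -scompA (proj2_sig h). Qed.

Definition wslice_post : smap (wslice q) (wslice (scomp p q)).
Proof.
exists (fun n h => wslice_mk (wslice_post_subproof h) : wslice (scomp p q) n).
by move=> m n f h; apply: sig_eq; rewrite /= scompA.
Defined.

End WideSlicePost.

Section InducedMap.
Variables (X S : sset) (p : smap X S).
Variables (u : smap (Delta 1) X) (x : smap (Delta 0) X).
Hypothesis hx : scomp u vertex0 = x.

Lemma induced_subproof : scomp (scomp p u) vertex0 = scomp p x.
Proof. by rewrite -scompA hx. Qed.

Definition wslice_fiber_product : sset :=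
  spullback (wslice_post p x) (wslice_restr induced_subproof).

Lemma induced_commutes :
  scomp (wslice_post p x) (wslice_restr hx) =
  scomp (wslice_restr induced_subproof) (wslice_post p u).
Proof. by apply: smap_eq => n h; apply: sig_eq; rewrite /= scompA. Qed.

(* The map X^{u/} -> X^{x/} x_{S^{p(x)/}} S^{p(u)/}. *)
Definition wslice_induced : smap (wslice u) wslice_fiber_product :=
  spullback_pair induced_commutes.

End InducedMap.

Definition monomorphism (A B : sset) (i : smap A B) : Prop :=
  forall (W : sset) (f g : smap W A), scomp i f = scomp i g -> f = g.

(* [p] has the right lifting property against [i]. *)
Definition rlp (A B X Y : sset) (i : smap A B) (p : smap X Y) : Prop :=
  forall (a : smap A X) (b : smap B Y), scomp p a = scomp b i ->
  exists h : smap B X, scomp h i = a /\ scomp p h = b.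

Definition inner_fibration (X S : sset) (p : smap X S) : Prop :=
  forall (n : nat) (k : 'I_n.+1), 0 < k < n -> rlp (horn_incl k) p.

Definition trivial_kan_fibration (X Y : sset) (p : smap X Y) : Prop :=
  forall (A B : sset) (i : smap A B), monomorphism i -> rlp i p.

Definition cocartesian (X S : sset) (p : smap X S) (u : smap (Delta 1) X) :
  Prop :=
  forall (n : nat) (a : smap (horn (ord0 : 'I_n.+3)) X)
    (b : smap (Delta n.+2) S),
  scomp p a = scomp b (horn_incl ord0) -> scomp a (horn_edge n) = u ->
  exists h : smap (Delta n.+2) X,
    scomp h (horn_incl ord0) = a /\ scomp p h = b.

(* Main.v *)
Require Import Defs.
From HB Require Import structures.
From mathcomp Require Import all_boot all_order.
From mathcomp Require Import boolp.
From mathcomp Require classical_sets.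
From mathcomp Require Import zify.

Set Implicit Arguments.
Unset Strict Implicit.
Unset Printing Implicit Defensive.

(** A map has the right lifting property against all monomorphisms as soon as
    it has it against the boundary inclusions ([trivial_kan_of_boundary]). For
    the map [wslice_induced] this property says that [p], relative to the edge
    [u], lifts against the inclusion into the wide join of [Delta 1] and
    [Delta n] of the wide joins of [Delta 1] with [boundary n] and of [Delta 0]
    with [Delta n]. With ordinary joins in place of wide ones this inclusion
    would be the left horn of [Delta n.+2] and there would be nothing to prove;
    the content of the theorem is the passage between the two joins.

    Both directions are extension problems on a product
    [Delta 1 x Delta e x Delta n] with [e = 1] or [e = 2]. Its simplices are
    determined by their vertices, which are triples [(t, s, b)]: [t] is the
    coordinate along the join. Write x = (0, 0), y = (0, 1), z1 = (1, 0),
    z2 = (1, 1), z3 = (1, 2) for the possible values of [(t, s)], and [z2_b] and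
    so on for the vertices. The simplices with coordinates in x, y, z1, z2
    (the case [e = 1]) describe the wide join: a map out of the wide join is a
    map out of [Delta 1 x Delta 1 x Delta n] which depends only on [s] where
    [t = 0] and only on [b] where [t = 1] ([wjoin_desc]).

    A partial lift is extended by fixing a vertex [q], the pivot, and attaching
    simplices in pairs formed by a simplex containing [q] and its face opposite
    to [q]; each pair is attached along a horn ([extends_pivot]). If [q] is
    neither the first nor the last vertex, this horn is inner. The pivots are
    [z1_v] for [v] from [n] down to 0, and then [x_v] for [v] from [n] down to 1.

    If [u] is cocartesian, one takes [e = 1], and the single pivot [x_0]
    remains. Here the horns are left outer ones, but the vertex after [x_0] is
    [y_0] and the edge between them is sent to [u], so that they can be filled
    because [u] is cocartesian ([extends_base_all], [fat_left_horn]).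

    Conversely, a lifting problem for the left horn of [Delta n.+2] is pulled
    back to the wide join along the map [crush], which sends x, y, [z_b] to the
    vertices 0, 1, [b + 2]; if [wslice_induced] is a trivial fibration, the
    pulled back problem has a solution. It can be evaluated on the simplex [x_0
    y_0 z2_0 .. z2_n], but there its boundary is not the given horn, because it
    differs on the faces opposite to [y_0] and to [z2_0]. This is repaired with
    a further layer of vertices z3 (the case [e = 2]). On simplices with
    vertices in x, y, z3 whose z3 part misses some [b] the given horn is
    imposed, regardless of the coordinate [b] of the vertices in x and y. All
    remaining simplices can be attached along inner horns
    ([extends_base_legal]), using the pivots [y_v] and [z2_v] as well. The
    value on [x_0 y_0 z3_0 .. z3_n] is then a filler of the given horn
    ([thin_filler]). *)

(** * Monotone maps and maps out of a simplex *)

Section MonotoneMaps.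
Variables (m n : nat) (f : 'I_m.+1 -> 'I_n.+1).
Hypothesis hf : forall i j : 'I_m.+1, i <= j -> f i <= f j.

Lemma mk_shom_subproof : {homo f : i j / (i <= j)%O}.
Proof. by move=> i j; rewrite !leEord; apply: hf. Qed.

Definition mk_shom : shom m n :=
  HB.pack_for (shom m n) f
    (Order.isOrderMorphism.Build _ _ _ _ f mk_shom_subproof).

Lemma mk_shomE i : mk_shom i = f i.
Proof. by []. Qed.

End MonotoneMaps.

Lemma shom_mono (m n : nat) (f : shom m n) (i j : 'I_m.+1) : i <= j -> f i <= f j.
Proof.
move=> ij; have := @Order.OrderMorphismTheory.omorph_le _ _ _ _ f i j.
by rewrite !leEord; apply.
Qed.

Lemma smap_eqP (X Y : sset) (f g : smap X Y) n (x : X n) : f = g -> f n x = g n x.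
Proof. by move=> ->. Qed.

Definition yoneda (X : sset) (n : nat) (x : X n) : smap (Delta n) X.
Proof.
by exists (fun m (f : Delta n m) => act f x) => m l h f; rewrite act_comp.
Defined.

Lemma yoneda_eq (X : sset) (n : nat) (h : smap (Delta n) X) m (f : Delta n m) :
  h m f = act f (h n (shom_id n)).
Proof. by rewrite -sfun_act; congr (h m _); apply: shom_eq. Qed.

Lemma smap_Delta_eq (X : sset) (n : nat) (h k : smap (Delta n) X) :
  h n (shom_id n) = k n (shom_id n) -> h = k.
Proof. by move=> e; apply: smap_eq => m f; rewrite yoneda_eq e -yoneda_eq. Qed.

(** * Partial lifts *)

(** A partial map is encoded by its graph, so that its domain need not be fixed in
    advance and unions of partial maps are again relations. *)
Definition srel (V X : sset) := forall m, V m -> X m -> Prop.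

Section PartialLift.
Variables (V X S : sset) (p : smap X S) (beta : smap V S).

Record plift (G : srel V X) : Prop := PLift {
  plift_act : forall m l (f : shom l m) v x, G m v x -> G l (act f v) (act f x);
  plift_fun : forall m v x x', G m v x -> G m v x' -> x = x';
  plift_over : forall m v x, G m v x -> p m x = beta m v }.

Definition sdom (G : srel V X) m (v : V m) : Prop := exists x, G m v x.

Definition srel_sub (G G' : srel V X) : Prop := forall m v x, G m v x -> G' m v x.

Lemma sdom_act (G : srel V X) : plift G ->
  forall m l (f : shom l m) v, sdom G v -> sdom G (act f v).
Proof. by move=> hG m l f v [x hx]; exists (act f x); apply: plift_act. Qed.

Lemma plift_total (G : srel V X) : plift G -> (forall m (v : V m), sdom G v) ->
  exists F : smap V X, (forall m v, G m v (F m v)) /\ scomp p F = beta.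
Proof.
move=> hG tot.
pose F m (v : V m) : X m := proj1_sig (cid (tot m v)).
have FG m v : G m v (F m v) by exact: proj2_sig (cid (tot m v)).
have Fact m n (f : shom m n) (v : V n) : F m (act f v) = act f (F n v).
  by apply: (plift_fun hG (FG _ _)); apply: plift_act.
exists (SMap Fact); split=> //.
by apply: smap_eq => n v /=; apply: plift_over hG _ _ _ (FG n v).
Qed.

Definition attach (G : srel V X) m (sg : V m) (h : smap (Delta m) X) : srel V X :=
  fun l v x => G l v x \/ exists2 f : Delta m l, v = act f sg & x = h l f.

(** Gluing one cell: [P] is the part of the boundary of [sg] that lies in the
    domain, and outside of [P] the simplex [sg] is injective and avoids the
    domain. The new domain is then the pushout of the old one and [Delta m] along
    [P], whence a filler of [P] extends the partial lift. *)
Lemma plift_attach (G : srel V X) m (sg : V m)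
    (P : forall n, Delta m n -> Prop)
    (hP : forall n l (f : shom n l) (s : Delta m l), P l s -> P n (act f s)) :
  plift G ->
  (forall l (f : Delta m l), P l f -> sdom G (act f sg)) ->
  (forall l (f : Delta m l), ~ P l f -> ~ sdom G (act f sg)) ->
  (forall l (f g : Delta m l), ~ P l f -> ~ P l g ->
     act f sg = act g sg -> f = g) ->
  (forall a : smap (ssub hP) X,
     (forall l (f : ssub hP l), G l (act (proj1_sig f) sg) (a l f)) ->
     scomp p a = scomp (scomp beta (yoneda sg)) (ssub_incl hP) ->
     exists h : smap (Delta m) X,
       scomp h (ssub_incl hP) = a /\ scomp p h = scomp beta (yoneda sg)) ->
  exists h, plift (attach G sg h).
Proof.
move=> hG hin hout hinj hfill.
pose a l (f : ssub hP l) : X l :=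
  proj1_sig (cid (hin l (proj1_sig f) (proj2_sig f))).
have aG l f : G l (act (proj1_sig f) sg) (a l f).
  exact: proj2_sig (cid (hin l (proj1_sig f) (proj2_sig f))).
have aact n l (g : shom n l) (f : ssub hP l) : a n (act g f) = act g (a l f).
  apply: (plift_fun hG (aG _ _)) => /=.
  by rewrite -[shom_comp _ _]/(shom_comp (proj1_sig f) g) act_comp; apply: plift_act.
have [|h [ha hb]] := hfill (SMap aact) aG.
  by apply: smap_eq => l f /=; apply: plift_over hG _ _ _ (aG l f).
have hE l (f : Delta m l) (hf : P l f) : h l f = a l (exist _ f hf).
  by have /(smap_eqP (exist _ f hf : ssub hP l)) := ha.
(* values on the new cell agree with [G] wherever both are defined *)
have hG' l (f : Delta m l) x : G l (act f sg) x -> x = h l f.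
  move=> hx; have hf : P l f by apply: contrapT => /hout; apply; exists x.
  by rewrite (hE _ _ hf); apply: (plift_fun hG hx (aG l (exist (P l) f hf))).
exists h; split.
- move=> k l f v x [hx|[g -> ->]]; first by left; apply: plift_act.
  by right; exists (shom_comp g f); rewrite ?act_comp // -sfun_act.
- move=> l v x x' [hx|[f ev ->]] [hx'|[g ev' ->]].
  + exact: (plift_fun hG hx hx').
  + by apply: hG'; rewrite -ev'.
  + by symmetry; apply: hG'; rewrite -ev.
  + have [hf|hf] := pselect (P l f).
      by apply: hG'; rewrite -ev' ev (hE _ _ hf); apply: (aG l (exist (P l) f hf)).
    have hg : ~ P l g by move=> /hin; rewrite -ev' ev; apply: hout.
    by rewrite (hinj _ _ _ hf hg) // -ev.
- move=> l v x [hx|[f -> ->]]; first exact: plift_over hG _ _ _ hx.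
  by have /(smap_eqP f) := hb.
Qed.

End PartialLift.

(** * Reduction to boundary inclusions *)

Lemma shom_section_mono (l m : nat) (f : shom l m) (d : 'I_m.+1 -> 'I_l.+1) :
  (forall j, f (d j) = j) -> forall i j : 'I_m.+1, i <= j -> d i <= d j.
Proof.
move=> fd i j; rewrite leq_eqVlt => /orP[/eqP/val_inj -> //|ij].
rewrite leqNgt; apply/negP => /ltnW/(shom_mono f); rewrite !fd.
by rewrite leqNgt ij.
Qed.

Lemma shom_inj_le (m n : nat) (e : shom m n) : injective e ->
  forall i : 'I_m.+1, i <= e i.
Proof.
move=> einj [k hk]; elim: k hk => [//|k IH] hk.
apply: leq_ltn_trans (IH (ltnW hk)) _ => /=.
rewrite ltn_neqAle (shom_mono e) ?andbT //.
by apply/eqP => /val_inj/einj/(congr1 val)/= /n_Sn.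
Qed.

Lemma shom_onto_id (m : nat) (e d : shom m m) :
  cancel d e -> forall i, e i = i.
Proof.
move=> de i; have ed := canF_sym de; apply/val_inj/anti_leq/andP; split.
  by rewrite -[leqRHS](congr1 val (de i)); apply/shom_mono/shom_inj_le/can_inj/de.
exact/shom_inj_le/can_inj/ed.
Qed.

(** The section can be chosen through any prescribed point; this freedom is what
    separates two surjections in [trivial_kan_of_boundary]. *)
Lemma boundaryN_section (l m : nat) (f : shom l m) (i : 'I_l.+1) :
  ~ boundary_pred (f : Delta m l) ->
  exists2 d : shom m l, forall j, f (d j) = j & d (f i) = i.
Proof.
move=> nf; have onto j : exists i', f i' = j.
  by apply: contrapT => nj; apply: nf; exists j => i' e; apply: nj; exists i'.
pose d j := if j == f i then i else proj1_sig (cid (onto j)).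
have fd j : f (d j) = j.
  by rewrite /d; case: eqP => [->//|_]; exact: proj2_sig (cid (onto j)).
exists (mk_shom (shom_section_mono fd)) => [j|]; first exact: fd.
by rewrite mk_shomE /d eqxx.
Qed.

(** Proper faces come from simplices of smaller dimension, to which minimality
    applies in [trivial_kan_of_boundary]. *)
Lemma misses_factor (l m : nat) (f : shom l m) (j : 'I_m.+1) :
  misses j (f : Delta m l) ->
  exists2 m', m = m'.+1 & exists (d : shom m' m) (g : shom l m'), f = shom_comp d g.
Proof.
case: m f j => [|m'] f j hj.
  by case: (hj ord0); rewrite (ord1 (f ord0)) (ord1 j).
exists m' => //.
have dm (i i' : 'I_m'.+1) : i <= i' -> lift j i <= lift j i'.
  by rewrite /= leq_bump2.
have fj i : j != f i by apply/eqP => e; apply: (hj i).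
pose g i : 'I_m'.+1 := s2val (unlift_some (fj i)).
have gE i : f i = lift j (g i) by rewrite /g; case: (unlift_some _).
have gm (i i' : 'I_l.+1) : i <= i' -> g i <= g i'.
  by move=> /(shom_mono f); rewrite !gE /= leq_bump2.
by exists (mk_shom dm), (mk_shom gm); apply: shom_eq => i; rewrite gE.
Qed.

Lemma monomorphism_inj (A B : sset) (i : smap A B) n :
  monomorphism i -> injective (i n).
Proof.
move=> hi x y exy.
have /(smap_eqP (shom_id n : Delta n n)) : yoneda x = yoneda y.
  by apply: hi; apply: smap_eq => m f /=; rewrite !sfun_act exy.
by rewrite /= !act_id.
Qed.

(** Skeletal induction: a partial lift whose domain misses a simplex can be
    extended over a missing simplex of least dimension, whose boundary is then
    in the domain; a maximal partial lift is therefore total. *)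
Lemma trivial_kan_of_boundary (X Y : sset) (p : smap X Y) :
  (forall n, rlp (boundary_incl n) p) -> trivial_kan_fibration p.
Proof.
move=> hp A B i mono_i a b hab.
pose G0 : srel B X := fun m v x => exists2 w : A m, v = i m w & x = a m w.
pose R (E : classical_sets.set {m & (B m * X m)%type}) : srel B X :=
  fun m v x => G0 m v x \/ E (existT _ m (v, x)).
have hG0 : plift p b G0.
  split=> [m l f _ _ [w -> ->]|m _ _ x' [w -> ->] [w' e ->]|m _ _ [w -> ->]].
  - by exists (act f w); rewrite sfun_act.
  - by rewrite (monomorphism_inj mono_i e).
  - by have /(smap_eqP w) := hab.
(* [G0] is kept outside of the sets of pairs, so that the empty chain is no
   exception. *)
have [C Ctot|E [hE maxE]] := @classical_sets.Zorn_bigcup _ (fun E => plift p b (R E)).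
  move=> tot.
  have dir m v x m' v' x' : R (classical_sets.bigcup C id) m v x ->
      R (classical_sets.bigcup C id) m' v' x' ->
      (G0 m v x /\ G0 m' v' x') \/
      exists2 E, C E & R E m v x /\ R E m' v' x'.
    move=> [g|[E CE e]] [g'|[E' CE' e']]; first by left.
    - by right; exists E' => //; split; [left|right].
    - by right; exists E => //; split; [right|left].
    - case: (tot _ _ CE CE') => sub; right.
      + by exists E' => //; split; right=> //; apply: sub.
      + by exists E => //; split; right=> //; apply: sub.
  split=> [m l f v x [g|[E CE e]]|m v x x' r r'|m v x r].
  - by left; apply: plift_act hG0 _ _ _ _ _ g.
  - have [g|e'] := plift_act (Ctot _ CE) f (or_intror e : R E _ v x); first by left.
    by right; exists E.
  - have [[g g']|[E CE [e e']]] := dir _ _ _ _ _ _ r r'.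
      exact: plift_fun hG0 _ _ _ _ g g'.
    exact: plift_fun (Ctot _ CE) _ _ _ _ e e'.
  - have [[g _]|[E CE [e _]]] := dir _ _ _ _ _ _ r r.
      exact: plift_over hG0 _ _ _ g.
    exact: plift_over (Ctot _ CE) _ _ _ e.
suff tot m (v : B m) : sdom (R E) v.
  have [F [FG Fb]] := plift_total hE tot; exists F; split=> //.
  by apply: smap_eq => n w /=; apply: (plift_fun hE (FG _ _)); left; exists w.
apply: contrapT => nv.
pose missing k := `[< exists w : B k, ~ sdom (R E) w >].
have hmiss : exists k, missing k by exists m; apply/asboolP; exists v.
case: (ex_minnP hmiss) => k /asboolP[sg nsg] mink {hmiss m v nv}.
have low l (w : B l) : l < k -> sdom (R E) w.
  move=> lk; apply: contrapT => nw.
  have /mink : missing l by apply/asboolP; exists w.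
  by rewrite leqNgt lk.
have faces l (f : Delta k l) : boundary_pred f -> sdom (R E) (act f sg).
  case=> j /misses_factor[k' ek [d [g ->]]]; rewrite act_comp.
  by apply: sdom_act hE _ _ _ _ _; apply: low; rewrite ek.
have nfaces l (f : Delta k l) : ~ boundary_pred f -> ~ sdom (R E) (act f sg).
  move=> nf hf; have [d fd _] := boundaryN_section ord0 nf; apply: nsg.
  have -> : sg = act d (act f sg).
    by rewrite -act_comp -[LHS]act_id; congr act; apply: shom_eq => i0 /=; rewrite fd.
  exact: (sdom_act hE).
(* two surjections with the same effect on a simplex that is not a degeneracy of
   one of its proper faces coincide: otherwise [g] composed with a section of [f]
   would be a proper operator fixing [sg] *)
have injf l (f g : Delta k l) : ~ boundary_pred f -> ~ boundary_pred g ->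
    act f sg = act g sg -> f = g.
  move=> nf ng efg; apply: shom_eq => i0.
  have [d fd di] := boundaryN_section i0 nf.
  have esg : act (shom_comp g d) sg = sg.
    rewrite act_comp -efg -act_comp -[RHS]act_id.
    by congr act; apply: shom_eq => j /=; rewrite fd.
  have [bgd|ngd] := pselect (boundary_pred (shom_comp g d : Delta k k)).
    by case: nsg; rewrite -esg; apply: faces.
  have [e he _] := boundaryN_section ord0 ngd.
  by rewrite -{2}di; apply: esym; apply: shom_onto_id he _.
have [|h hh] := plift_attach (hP := @boundary_closed k) hE faces nfaces injf.
  by move=> al _ hal; apply: hp.
pose E' (z : {m & (B m * X m)%type}) : Prop :=
  E z \/ exists2 f : Delta k (projT1 z),
    (projT2 z).1 = act f sg & (projT2 z).2 = h _ f.
apply: (maxE E').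
  split=> [z|sub]; first by left.
  apply: nsg; exists (h k (shom_id k)); right.
  by apply: sub; right; exists (shom_id k); rewrite ?act_id.
suff -> : R E' = attach (R E) sg h by [].
apply: functional_extensionality_dep => l.
apply/funext => w; apply/funext => x; apply/propext.
by rewrite /R /attach /E' /=; split=> [[|[]]|[[]|]]; auto.
Qed.

(** * Simplices of a product of three standard simplices *)

Definition cube3 (a b c : nat) : sset := sprod (sprod (Delta a) (Delta b)) (Delta c).

Section Cube.
Variables a b c : nat.

Definition pt : finType := ('I_a.+1 * 'I_b.+1 * 'I_c.+1)%type.

Definition lept : rel pt :=
  fun p q => [&& p.1.1 <= q.1.1, p.1.2 <= q.1.2 & p.2 <= q.2].

Lemma lept_refl : reflexive lept.
Proof. by move=> p; rewrite /lept !leqnn. Qed.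

Lemma lept_trans : transitive lept.
Proof.
move=> q p r /and3P[h1 h2 h3] /and3P[k1 k2 k3].
by apply/and3P; split; [apply: leq_trans k1|apply: leq_trans k2|apply: leq_trans k3].
Qed.

Lemma lept_anti : antisymmetric lept.
Proof.
move=> [[p1 p2] p3] [[q1 q2] q3] /andP[/and3P[/= h1 h2 h3] /and3P[/= k1 k2 k3]].
by congr (_, _, _); apply/val_inj/anti_leq/andP.
Qed.

Definition vtx m (v : cube3 a b c m) (i : 'I_m.+1) : pt :=
  ((v.1.1 : shom m a) i, (v.1.2 : shom m b) i, (v.2 : shom m c) i).

Lemma vtx_act m l (f : shom l m) (v : cube3 a b c m) i :
  vtx (act f v) i = vtx v (f i).
Proof. by []. Qed.

Lemma vtx_mono m (v : cube3 a b c m) (i j : 'I_m.+1) :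
  i <= j -> lept (vtx v i) (vtx v j).
Proof. by move=> ij; apply/and3P; split; apply: shom_mono. Qed.

Lemma vtx_inj m (v w : cube3 a b c m) : vtx v =1 vtx w -> v = w.
Proof.
case: v w => [[v1 v2] v3] [[w1 w2] w3] e.
by congr (_, _, _); apply: shom_eq => i; case: (e i).
Qed.

Lemma vtx_surj m (f : 'I_m.+1 -> pt) :
  (forall i j : 'I_m.+1, i <= j -> lept (f i) (f j)) ->
  exists v : cube3 a b c m, vtx v =1 f.
Proof.
move=> hf.
have h1 (i j : 'I_m.+1) : i <= j -> (f i).1.1 <= (f j).1.1 by move/hf/and3P => [].
have h2 (i j : 'I_m.+1) : i <= j -> (f i).1.2 <= (f j).1.2 by move/hf/and3P => [].
have h3 (i j : 'I_m.+1) : i <= j -> (f i).2 <= (f j).2 by move/hf/and3P => [].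
exists ((mk_shom h1 : Delta a m, mk_shom h2 : Delta b m), mk_shom h3 : Delta c m).
by move=> i; rewrite /vtx /=; case: (f i) => [[]].
Qed.

Definition supp m (v : cube3 a b c m) : {set pt} := [set vtx v i | i : 'I_m.+1].

Lemma supp_vtx m (v : cube3 a b c m) i : vtx v i \in supp v.
Proof. exact: imset_f. Qed.

Lemma supp_act m l (f : shom l m) (v : cube3 a b c m) : supp (act f v) \subset supp v.
Proof. by apply/subsetP => _ /imsetP[i _ ->]; rewrite vtx_act supp_vtx. Qed.

Definition chain (d : {set pt}) : Prop :=
  forall p q, p \in d -> q \in d -> lept p q \/ lept q p.

Lemma chain_sub (d e : {set pt}) : d \subset e -> chain e -> chain d.
Proof. by move=> /subsetP de he p q /de pe /de qe; apply: he. Qed.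

Lemma chain_supp m (v : cube3 a b c m) : chain (supp v).
Proof.
move=> _ _ /imsetP[i _ ->] /imsetP[j _ ->].
by case/orP: (leq_total i j) => ij; [left|right]; apply: vtx_mono.
Qed.

Lemma vtx_le m (v : cube3 a b c m) : injective (vtx v) ->
  forall i j, lept (vtx v i) (vtx v j) -> i <= j.
Proof.
move=> vinj i j le; rewrite leqNgt; apply/negP => ji.
have e : vtx v i = vtx v j.
  by apply: lept_anti; rewrite le vtx_mono // ltnW.
by move: ji; rewrite (vinj _ _ e) ltnn.
Qed.

(** A nondegenerate simplex has every simplex supported on its vertices as a face
    or degeneracy, so the domain of a partial lift is determined by the vertex
    sets of its simplices. *)
Lemma supp_sub_act m l (v : cube3 a b c m) (w : cube3 a b c l) :
  injective (vtx v) -> supp w \subset supp v -> exists f : shom l m, w = act f v.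
Proof.
move=> vinj /subsetP sub.
have ex i : exists j, vtx v j = vtx w i.
  by have /imsetP[j _ ->] := sub _ (supp_vtx w i); exists j.
pose f i := proj1_sig (cid (ex i)).
have fE i : vtx v (f i) = vtx w i by exact: proj2_sig (cid (ex i)).
have fm (i j : 'I_l.+1) : i <= j -> f i <= f j.
  by move=> ij; apply: (vtx_le vinj); rewrite !fE; apply: vtx_mono.
by exists (mk_shom fm); apply: vtx_inj => i; rewrite vtx_act mk_shomE fE.
Qed.

Lemma chain_simplex (d : {set pt}) : chain d -> d != set0 ->
  exists m (v : cube3 a b c m), injective (vtx v) /\ supp v = d.
Proof.
move=> hd /set0Pn[p0 p0d].
pose s := sort lept (enum d).
have ss : sorted lept s.
  apply: (@sort_sorted_in _ (mem d)); last by apply/allP => p; rewrite mem_enum.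
  by move=> p q pd qd; apply/orP/hd.
have sus : uniq s by rewrite sort_uniq enum_uniq.
have mems p : (p \in s) = (p \in d) by rewrite mem_sort mem_enum.
have sz : size s = (size s).-1.+1.
  by case: (s) (mems p0) => //; rewrite p0d.
have ltsz (i : 'I_(size s).-1.+1) : i < size s by rewrite [ltnRHS]sz.
have [|v hv] := @vtx_surj (size s).-1 (fun i => nth p0 s i).
  move=> i j ij; apply: (sorted_leq_nth lept_trans lept_refl p0 ss) => //.
  - exact: ltsz.
  - exact: ltsz.
exists (size s).-1, v; split.
  by move=> i j; rewrite !hv => /eqP; rewrite nth_uniq // => /eqP/val_inj.
apply/setP => p; rewrite -mems; apply/imsetP/(nthP p0) => [[i _ ->]|[i hi <-]].
  by exists i; rewrite ?hv.
by rewrite sz in hi; exists (Ordinal hi); rewrite ?hv.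
Qed.

End Cube.

(** * Extension of partial lifts along a pivot *)

Section Pivot.
Variables (a b c : nat) (X S : sset) (p : smap X S) (beta : smap (cube3 a b c) S).
Implicit Types (F K : {set pt a b c} -> Prop) (E G : srel (cube3 a b c) X).

Definition downset F := forall d e : {set pt a b c}, d \subset e -> F e -> F d.

Definition lift_on F G :=
  plift p beta G /\ forall m (v : cube3 a b c m), sdom G v <-> F (supp v).

(** [E] is a relation contained in all the partial lifts under consideration; it
    records the values that are needed to fill outer horns. *)
Definition extends E F K := forall G, lift_on F G -> srel_sub E G ->
  exists2 G', lift_on K G' & srel_sub G G'.

Lemma extends_trans E F K L : extends E F K -> extends E K L -> extends E F L.
Proof.
move=> FK KL G hF EG; have [G' hK GG'] := FK G hF EG.
have [|G'' hL GG''] := KL G' hK; first by move=> m v x /EG/GG'.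
by exists G'' => // m v x /GG'/GG''.
Qed.

Lemma extends_iff E F K :
  (forall d, chain d -> d != set0 -> (F d <-> K d)) -> extends E F K.
Proof.
move=> FK G [hG dG] _; exists G => //; split=> // m v.
rewrite dG; apply: FK; first exact: chain_supp.
by apply/set0Pn; exists (vtx v ord0); apply: supp_vtx.
Qed.

(** The condition on [al] is what makes left outer horns fillable along [u]. *)
Definition horn_fillable E m (v : cube3 a b c m) (k : 'I_m.+1) :=
  forall al : smap (horn k) X,
  (forall l (f : horn k l) x, E l (act (proj1_sig f) v) x -> al l f = x) ->
  scomp p al = scomp (scomp beta (yoneda v)) (horn_incl k) ->
  exists h : smap (Delta m) X,
    scomp h (horn_incl k) = al /\ scomp p h = scomp beta (yoneda v).

Definition fillable_at E (d : {set pt a b c}) (q : pt a b c) :=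
  forall m (v : cube3 a b c m) k, injective (vtx v) -> supp v = d -> vtx v k = q ->
  horn_fillable E v k.

Lemma fillable_inner E (d : {set pt a b c}) q q1 q2 : inner_fibration p ->
  q1 \in d -> q1 != q -> lept q1 q -> q2 \in d -> q2 != q -> lept q q2 ->
  fillable_at E d q.
Proof.
move=> hp q1d n1 l1 q2d n2 l2 m v k vinj sd vk al _ hal.
apply: hp => //; move: q1d q2d; rewrite -sd => /imsetP[i _ e1] /imsetP[j _ e2].
subst q1 q2 q; apply/andP; split.
  apply: leq_ltn_trans (leq0n i) _; rewrite ltn_neqAle (vtx_le vinj l1) andbT.
  by apply: contra n1 => /eqP/val_inj ik; rewrite ik.
apply: leq_trans (leq_ord j); rewrite ltn_neqAle (vtx_le vinj l2) andbT.
by apply: contra n2 => /eqP/val_inj kj; rewrite kj.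
Qed.

(** The simplex with vertex set [d] meets the domain exactly in the horn at [q]. *)
Lemma extends_cell E F d q :
  downset F -> chain d -> q \in d -> ~ F (d :\ q) ->
  (forall q', q' \in d -> q' != q -> F (d :\ q')) -> fillable_at E d q ->
  extends E F (fun e => [\/ F e, e = d | e = d :\ q]).
Proof.
move=> dF hd qd nF hF fill G [hG dG] EG.
have [|m [v [vinj sv]]] := chain_simplex hd; first by apply/set0Pn; exists q.
have [k _ vk] : exists2 k, k \in 'I_m.+1 & q = vtx v k.
  by apply/imsetP; rewrite -/(supp v) sv.
have sub_act l (f : shom l m) : supp (act f v) \subset d by rewrite -sv supp_act.
have inF l (f : Delta m l) : horn_pred k f -> sdom G (act f v).
  case=> j jk hj; apply/dG; apply: dF (hF (vtx v j) _ _); first last.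
  - by rewrite vk; apply: contra jk => /eqP/vinj->.
  - by rewrite -sv supp_vtx.
  apply/subsetP => x xf; rewrite !inE (subsetP (sub_act _ _) x xf) andbT.
  case/imsetP: xf => i _ ->; rewrite vtx_act; apply/eqP => /vinj; exact: hj.
have suppN l (f : Delta m l) : ~ horn_pred k f -> d :\ q \subset supp (act f v).
  move=> nf; apply/subsetP => x; rewrite !inE -{1}sv => /andP[xq /imsetP[j _ xj]].
  have jk : j != k by apply: contra xq => /eqP e; rewrite xj vk e.
  have [i fi] : exists i, (f : shom l m) i = j.
    by apply: contrapT => ni; apply: nf; exists j => // i fi; apply: ni; exists i.
  by rewrite xj -fi -vtx_act supp_vtx.
have outF l (f : Delta m l) : ~ horn_pred k f -> ~ sdom G (act f v).
  by move=> /suppN sub /dG /(dF _ _ sub).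
have [||h hh] := plift_attach (hP := @horn_closed m k) hG inF outF.
- move=> l f g _ _ efg; apply: shom_eq => i; apply: vinj.
  by rewrite -!vtx_act efg.
- move=> al hal; apply: (fill m v k vinj sv (esym vk)) => l f x /EG.
  exact: plift_fun hG _ _ _ _ (hal l f).
exists (attach G v h); last by move=> *; left.
split=> // l w; split=> [[x [wx|[f -> _]]]|].
- by constructor 1; apply/dG; exists x.
- have [/inF/dG|/suppN sub] := pselect (horn_pred k f); first by constructor 1.
  have [qf|nqf] := boolP (q \in supp (act f v)).
    constructor 2; apply/eqP; rewrite eqEsubset sub_act.
    by rewrite -(setD1K qd) subUset sub1set qf.
  constructor 3; apply/eqP; rewrite eqEsubset sub andbT.
  by rewrite subsetD1 sub_act nqf.
- move=> hw; have [/dG[x wx]|sw] : F (supp w) \/ supp w \subset supp v.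
  + by case: hw => [|->|->]; [left|right|right]; rewrite // sv // subD1set.
  + by exists x; left.
  + by have [f ->] := supp_sub_act vinj sw; exists (h l f); right; exists f.
Qed.

(** The pairs [q |: d], [d :\ q] are attached in order of increasing cardinality.
    A face of [q |: d] opposite to a vertex other than [q] still contains [q], so
    it belongs to a smaller pair or to [F]; hence only the face opposite to [q]
    is missing. *)
Lemma extends_pivot E F K q :
  downset F -> downset K -> (forall d, F d -> K d) ->
  (forall d, chain d -> K d -> ~ F d ->
    [/\ chain (q |: d), K (q |: d), ~ F (d :\ q) & fillable_at E (q |: d) q]) ->
  extends E F K.
Proof.
move=> dF dK FK hq.
pose todo F' := [set d | `[< chain d /\ K d /\ ~ F' d >] ].
have [N] := ubnP #|todo F|; elim: N => // N IH in F dF FK hq *; rewrite ltnS => leN.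
have [t0|[d0 d0t]] := set_0Vmem (todo F).
  apply: extends_iff => d hd _; split=> [|Kd]; first exact: FK.
  apply: contrapT => nF; have : d \in todo F by rewrite inE; apply/asboolP.
  by rewrite t0 inE.
(* induction on the number of missing sets, attaching a smallest pair *)
case: (@arg_minnP _ d0 (mem (todo F)) (fun d => #|q |: d|) d0t) => d1.
rewrite /= inE => /asboolP[ch1 [K1 nF1]] min1 {d0 d0t}.
have [ch Kd nFq fill] := hq _ ch1 K1 nF1.
set d := q |: d1 in ch Kd fill min1; have qd : q \in d by rewrite setU11.
have eDq : d :\ q = d1 :\ q by apply/setP => x; rewrite !inE; case: eqVneq.
pose F' e := [\/ F e, e = d | e = d :\ q].
have hface q' : q' \in d -> q' != q -> F (d :\ q').
  move=> q'd q'q; apply: contrapT => nF.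
  have /min1 : d :\ q' \in todo F.
    rewrite inE; apply/asboolP; split; first exact: chain_sub (subD1set _ _) ch.
    by split=> //; apply: dK Kd; apply: subD1set.
  have -> : q |: (d :\ q') = d :\ q'.
    by apply/setUidPr; rewrite sub1set !inE eq_sym q'q eqxx.
  by rewrite [#|d|](cardsD1 q') q'd ltnn.
apply: (@extends_trans _ _ F').
  by apply: extends_cell => //; rewrite eDq.
have sub_d (e : {set pt a b c}) : e \subset d -> F' e.
  move=> ed; have [->|ned] := eqVneq e d; first by constructor 2.
  have [q' q'd q'e] : exists2 q', q' \in d & q' \notin e.
    by apply/subsetPn; apply: contra ned => de; rewrite eqEsubset ed.
  have [q'q|q'q] := eqVneq q' q; last first.
    constructor 1; apply: dF (hface _ q'd q'q).
    by rewrite subsetD1 ed.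
  have [e1|] := eqVneq e (d :\ q); first by constructor 3.
  subst q'; move=> ne; have [r rd re] : exists2 r, r \in d :\ q & r \notin e.
    by apply/subsetPn; apply: contra ne => de; rewrite eqEsubset de subsetD1 ed q'e.
  move: rd; rewrite !inE => /andP[rq rd]; constructor 1.
  by apply: dF (hface r _ rq); rewrite ?subsetD1 ?ed // !inE rd.
apply: IH.
- move=> e e' ee' [Fe'|e'd|e'd]; first by constructor 1; apply: dF Fe'.
    by apply: sub_d; rewrite -e'd.
  by apply: sub_d; apply: subset_trans ee' _; rewrite e'd subD1set.
- move=> e [/FK //|->//|->]; apply: dK Kd; exact: subD1set.
- move=> e che Ke nF'e.
  have nFe : ~ F e by move=> Fe; apply: nF'e; constructor 1.
  have [? ? nFeq ?] := hq _ che Ke nFe; split=> // -[//|ed|ed].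
    by move: qd; rewrite -ed !inE eqxx.
  apply: nF'e; apply: sub_d; apply/subsetP => x xe.
  have [->//|xq] := eqVneq x q.
  by apply: (subsetP (subD1set d q)); rewrite -ed !inE xq.
apply: leq_trans leN; apply: proper_card; apply/properP; split.
  apply/subsetP => e; rewrite !inE => /asboolP[che [Ke nF'e]].
  by apply/asboolP; split=> //; split=> // Fe; apply: nF'e; constructor 1.
exists d.
  rewrite inE; apply/asboolP; split=> //; split=> // Fd; apply: nFq.
  by apply: dF Fd; rewrite -eDq subD1set.
by rewrite inE; apply/asboolP => -[_ [_]]; apply; constructor 2.
Qed.

End Pivot.

(** * The filtrations by pivots *)

Section Stages.
Variables (e n : nat).
Hypothesis e_gt0 : 0 < e.
Notation Q := (pt 1 e n).
Implicit Types (d : {set Q}) (q r : Q).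

Definition pt_t q : nat := q.1.1.
Definition pt_s q : nat := q.1.2.
Definition pt_b q : nat := q.2.

Definition mkpt (t s b : nat) : Q := (inord t, inord s, inord b).

Lemma mkptE t s b : t <= 1 -> s <= e -> b <= n ->
  pt_t (mkpt t s b) = t /\ pt_s (mkpt t s b) = s /\ pt_b (mkpt t s b) = b.
Proof. by move=> ht hs hb; rewrite /pt_t /pt_s /pt_b /= !inordK. Qed.

Lemma pt_bound q : pt_t q <= 1 /\ pt_s q <= e /\ pt_b q <= n.
Proof. by split; [|split]; apply: leq_ord. Qed.

Lemma leptE q r :
  lept q r = [&& pt_t q <= pt_t r, pt_s q <= pt_s r & pt_b q <= pt_b r].
Proof. by []. Qed.

Lemma pt_neq q r :
  (q != r) = [|| pt_t q != pt_t r, pt_s q != pt_s r | pt_b q != pt_b r].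
Proof.
by rewrite /pt_t /pt_s /pt_b !val_eqE -!negb_and; congr negb;
  case: q r => [[? ?] ?] [[? ?] ?]; rewrite !xpair_eqE andbA.
Qed.

Lemma not_all_in (d : {set Q}) (P : Q -> Prop) :
  ~ (forall q, q \in d -> P q) -> exists2 q, q \in d & ~ P q.
Proof.
move=> h; apply: contrapT => k; apply: h => q qd.
by apply: contrapT => nq; apply: k; exists q.
Qed.

Lemma chainU1 d q : chain d -> (forall r, r \in d -> lept q r \/ lept r q) ->
  chain (q |: d).
Proof.
move=> hd hq r1 r2; rewrite !inE => /orP[/eqP->|r1d] /orP[/eqP->|r2d].
- by left; apply: lept_refl.
- exact: hq.
- by case: (hq _ r1d); [right|left].
- exact: hd.
Qed.

(** The vertices [(0, 2)] lie in the product but not in the diagram of layers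
    x, y, z1, z2, z3. *)
Definition legal d := forall q, q \in d -> ~ (pt_t q = 0 /\ pt_s q = 2).

Definition misses_level d := exists2 j, j <= n & forall q, q \in d -> pt_b q <> j.

Definition thin_misses_level d := exists2 j, j <= n &
  forall q, q \in d -> pt_t q = 1 -> pt_s q = 2 /\ pt_b q <> j.

(** The vertex sets on which data are given. The flag [w] adds the simplices of
    the wide join, that is those without vertices in z3. The other clauses describe
    simplices that [crush] sends into the left horn. Among legal sets, the second
    clause leaves only x, z1, z3. *)
Definition given (w : bool) d : Prop :=
  [\/ w /\ forall q, q \in d -> pt_s q <> 2,
      forall q, q \in d -> pt_s q <> 1,
      forall q, q \in d -> pt_t q = 0 |
      [\/ forall q, q \in d -> pt_t q = 1, misses_level d | thin_misses_level d]].

Definition base w d := legal d /\ given w d.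

(** In each of the following families the bound [v] goes down one step at a time,
    and the pivot of a step is the vertex of level [v] in the layer that names the
    family. The sets added in a step contain the vertex of level [v] of the layer
    subject to the bound, and so the pivot is comparable to all of their elements
    and its level is covered without it. The clauses of [stage_y] and [stage_z2]
    in which [v] does not occur are those of the families reached before. *)
Definition stage_z1 w v d := legal d /\ (given w d \/ forall q, q \in d ->
  ~ (pt_t q = 0 /\ pt_s q = 1) /\ (pt_t q = 1 -> pt_s q = 1 -> v <= pt_b q)).

Definition stage_x w v d := legal d /\ (given w d \/ forall q, q \in d ->
  pt_t q = 0 -> pt_s q = 1 -> v <= pt_b q).

Definition stage_y v d := legal d /\ [\/ given true d,
  forall q, q \in d -> pt_t q = 0 -> pt_s q = 1 -> 1 <= pt_b q |
  forall q, q \in d -> (pt_t q = 1 -> pt_s q = 1 -> v <= pt_b q) /\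
                       (pt_t q = 1 -> pt_s q = 2 -> 1 <= pt_b q)].

Definition stage_z2 v d := legal d /\ [\/ given true d,
  forall q, q \in d -> pt_t q = 0 -> pt_s q = 1 -> 1 <= pt_b q,
  forall q, q \in d -> (pt_t q = 1 -> pt_s q = 1 -> 1 <= pt_b q) /\
                       (pt_t q = 1 -> pt_s q = 2 -> 1 <= pt_b q) |
  forall q, q \in d -> pt_t q = 1 -> pt_s q = 2 -> v <= pt_b q].

Lemma legal_down : downset legal.
Proof. by move=> d d' /subsetP dd' hd q /dd'; apply: hd. Qed.

Lemma given_down w : downset (given w).
Proof.
move=> d d' /subsetP dd'; have sub P : (forall q, q \in d' -> P q) ->
  forall q, q \in d -> P q by move=> h q /dd'/h.
case=> [[hw h]|h|h|[h|[j hj h]|[j hj h]]].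
- by constructor 1; split=> //; apply: sub.
- by constructor 2; apply: sub.
- by constructor 3; apply: sub.
- by constructor 4; constructor 1; apply: sub.
- by constructor 4; constructor 2; exists j => //; apply: sub.
- by constructor 4; constructor 3; exists j => //; apply: sub.
Qed.

Lemma stage_z1_down w v : downset (stage_z1 w v).
Proof.
move=> d d' dd' [U H]; split; first exact: legal_down U.
by case: H => [/(given_down dd')|h]; [left|right=> q /(subsetP dd')/h].
Qed.

Lemma stage_x_down w v : downset (stage_x w v).
Proof.
move=> d d' dd' [U H]; split; first exact: legal_down U.
by case: H => [/(given_down dd')|h]; [left|right=> q /(subsetP dd')/h].
Qed.

Lemma stage_y_down v : downset (stage_y v).
Proof.
move=> d d' dd' [U H]; split; first exact: legal_down U.
by case: H => [/(given_down dd')|h|h]; [constructor 1|constructor 2=> q /(subsetP dd')/h|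
  constructor 3=> q /(subsetP dd')/h].
Qed.

Lemma stage_z2_down v : downset (stage_z2 v).
Proof.
move=> d d' dd' [U H]; split; first exact: legal_down U.
by case: H => [/(given_down dd')|h|h|h]; [constructor 1|constructor 2=> q /(subsetP dd')/h|
  constructor 3=> q /(subsetP dd')/h|constructor 4=> q /(subsetP dd')/h].
Qed.

(** Removing [q] creates no new reason to be in [given] if the features that keep a
    set out of [given] are all witnessed by other vertices. The last clause of
    [given] has no such uniform witness and is left as a hypothesis. *)
Lemma given_setD1 w d q q1 q2 q3 q4 : pt_s q != 2 ->
  q1 \in d :\ q -> pt_s q1 = 1 -> q2 \in d :\ q -> pt_t q2 = 0 ->
  q3 \in d :\ q -> pt_t q3 = 1 -> q4 \in d :\ q -> pt_b q4 = pt_b q ->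
  (thin_misses_level (d :\ q) -> given w d) -> given w (d :\ q) -> given w d.
Proof.
move=> sq q1d s1 q2d t2 q3d t3 q4d b4 thin.
have split_q r : r \in d -> r = q \/ r \in d :\ q.
  by move=> rd; have [->|rq] := eqVneq r q; [left|right; rewrite !inE rq].
case=> [[hw h]|h|h|[h|[j hj h]|th]].
- constructor 1; split=> // r /split_q[->|/h//]; lia.
- by have := h _ q1d; rewrite s1.
- by have := h _ q3d; rewrite t3.
- by have := h _ q2d; rewrite t2.
- constructor 4; constructor 2; exists j => // r /split_q[->|/h//].
  by rewrite -b4; apply: h.
- exact: thin.
Qed.

Variables (X S : sset) (p : smap X S) (beta : smap (cube3 1 e n) S).
Hypothesis hp : inner_fibration p.
Variable E : srel (cube3 1 e n) X.
Notation ext := (extends p beta E).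

Lemma extends_down (fam : nat -> {set Q} -> Prop) (k m : nat) : k <= m ->
  (forall v, k <= v < m -> ext (fam v.+1) (fam v)) -> ext (fam m) (fam k).
Proof.
move=> km; rewrite -(subnK km); elim: (m - k) => [_|i IH h].
  by rewrite add0n; apply: extends_iff.
apply: (@extends_trans _ _ _ _ _ _ _ _ _ (fam (i + k))).
  by rewrite addSn; apply: h; lia.
by apply: IH => v hv; apply: h; lia.
Qed.

Lemma extends_stage_z1 w v : v <= n -> ext (stage_z1 w v.+1) (stage_z1 w v).
Proof.
move=> vn; pose q0 := mkpt 1 0 v.
have h0 : pt_t q0 = 1 /\ pt_s q0 = 0 /\ pt_b q0 = v by apply: mkptE.
apply: (@extends_pivot _ _ _ _ _ _ _ _ _ _ q0).
- exact: stage_z1_down.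
- exact: stage_z1_down.
- by move=> d [U [k|h]]; split=> //; [left|right=> q /h; lia].
move=> d hd [U H] nF.
have nK : ~ given w d by move=> k; apply: nF; split=> //; left.
have {}H : forall q, q \in d ->
  ~ (pt_t q = 0 /\ pt_s q = 1) /\ (pt_t q = 1 -> pt_s q = 1 -> v <= pt_b q).
  by case: H.
have [q1 q1d h1] : exists2 q1, q1 \in d & pt_t q1 = 1 /\ pt_s q1 = 1 /\ pt_b q1 = v.
  have /not_all_in[q1 q1d nq1] : ~ forall q, q \in d ->
    ~ (pt_t q = 0 /\ pt_s q = 1) /\ (pt_t q = 1 -> pt_s q = 1 -> v < pt_b q).
    by move=> h; apply: nF; split=> //; right.
  by exists q1 => //; have := H _ q1d; have := pt_bound q1; lia.
have [q2 q2d h2] : exists2 q2, q2 \in d & pt_t q2 = 0 /\ pt_s q2 = 0 /\ pt_b q2 <= v.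
  have /not_all_in[q2 q2d nq2] : ~ forall q, q \in d -> pt_t q = 1.
    by move=> h; apply: nK; constructor 4; constructor 1.
  exists q2 => //; have := H _ q2d; have := U _ q2d; have := pt_bound q2.
  by have := hd _ _ q1d q2d; rewrite !leptE; lia.
split.
- apply: chainU1 => // r rd; rewrite !leptE.
  have := H _ rd; have := U _ rd; have := pt_bound r; have := hd _ _ q1d rd.
  by rewrite !leptE; lia.
- split=> [r|]; first by rewrite !inE => /orP[/eqP->|/U//]; lia.
  by right=> r; rewrite !inE => /orP[/eqP->|/H//]; lia.
- have q1d' : q1 \in d :\ q0 by rewrite !inE q1d pt_neq; lia.
  have q2d' : q2 \in d :\ q0 by rewrite !inE q2d pt_neq; lia.
  case=> _ [k|h]; last by have := h _ q1d'; lia.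
  apply: nK; apply: (given_setD1 _ q1d' _ q2d' _ q1d' _ q1d') k; rewrite ?leptE; try lia.
  by case=> j _ h; have := h _ q1d'; lia.
- apply: (fillable_inner (q1 := q2) (q2 := q1)) => //.
  all: rewrite ?inE ?q1d ?q2d ?pt_neq ?leptE ?orbT //; lia.
Qed.

(** The pivot [x_v] precedes [y_v]. The horns are inner for [0 < v] and left outer
    for [v = 0]; their fillability is therefore a hypothesis. *)
Lemma extends_stage_x w v : v <= n ->
  (forall d, chain d -> stage_x w v d -> ~ stage_x w v.+1 d ->
     fillable_at p beta E (mkpt 0 0 v |: d) (mkpt 0 0 v)) ->
  ext (stage_x w v.+1) (stage_x w v).
Proof.
move=> vn fill; pose q0 := mkpt 0 0 v.
have h0 : pt_t q0 = 0 /\ pt_s q0 = 0 /\ pt_b q0 = v by apply: mkptE.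
apply: (@extends_pivot _ _ _ _ _ _ _ _ _ _ q0).
- exact: stage_x_down.
- exact: stage_x_down.
- by move=> d [U [k|h]]; split=> //; [left|right=> q /h; lia].
move=> d hd Fd nF; have [U H] := Fd.
have nK : ~ given w d by move=> k; apply: nF; split=> //; left.
have {}H : forall q, q \in d -> pt_t q = 0 -> pt_s q = 1 -> v <= pt_b q by case: H.
have [q1 q1d h1] : exists2 q1, q1 \in d & pt_t q1 = 0 /\ pt_s q1 = 1 /\ pt_b q1 = v.
  have /not_all_in[q1 q1d nq1] : ~ forall q, q \in d ->
    pt_t q = 0 -> pt_s q = 1 -> v < pt_b q.
    by move=> h; apply: nF; split=> //; right.
  by exists q1 => //; have := H _ q1d; have := pt_bound q1; lia.
have [q2 q2d h2] : exists2 q2, q2 \in d & pt_t q2 = 1.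
  have /not_all_in[q2 q2d nq2] : ~ forall q, q \in d -> pt_t q = 0.
    by move=> h; apply: nK; constructor 3.
  by exists q2 => //; have := pt_bound q2; lia.
split.
- apply: chainU1 => // r rd; rewrite !leptE.
  have := H _ rd; have := U _ rd; have := pt_bound r; have := hd _ _ q1d rd.
  by rewrite !leptE; lia.
- split=> [r|]; first by rewrite !inE => /orP[/eqP->|/U//]; lia.
  by right=> r; rewrite !inE => /orP[/eqP->|/H//]; lia.
- have q1d' : q1 \in d :\ q0 by rewrite !inE q1d pt_neq; lia.
  have q2d' : q2 \in d :\ q0 by rewrite !inE q2d pt_neq; lia.
  case=> _ [k|h]; last by have := h _ q1d'; lia.
  apply: nK; apply: (given_setD1 _ q1d' _ q1d' _ q2d' _ q1d') k; try lia.
  case=> j hj h; constructor 4; constructor 3; exists j => // r rd.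
  have [->|rq] := eqVneq r q0; first by lia.
  by apply: h; rewrite !inE rq.
- exact: fill.
Qed.

Lemma extends_base_stage_x1 w : ext (base w) (stage_x w 1).
Proof.
apply: (@extends_trans _ _ _ _ _ _ _ _ _ (stage_z1 w n.+1)).
  apply: extends_iff => d _ _; split=> -[U H]; split=> //; first by left.
  case: H => // h; constructor 2 => q qd.
  by have := h _ qd; have := pt_bound q; lia.
apply: (@extends_trans _ _ _ _ _ _ _ _ _ (stage_z1 w 0)).
  by apply: extends_down => // v; rewrite ltnS => /andP[_]; apply: extends_stage_z1.
apply: (@extends_trans _ _ _ _ _ _ _ _ _ (stage_x w n.+1)).
  apply: extends_iff => d _ _; split=> -[U [k|h]]; split=> //; [by left| |by left|];
    by right=> q qd; have := h _ qd; have := pt_bound q; lia.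
apply: (@extends_down (stage_x w)) => // v /andP[v1]; rewrite ltnS => vn.
(* level 0 is covered by a vertex below [y_v], necessarily [x_0], so that the
   pivot [x_v] is not the first vertex *)
apply: extends_stage_x => // d hd [U H] nF.
have nK : ~ given w d by move=> k; apply: nF; split=> //; left.
have {}H : forall q, q \in d -> pt_t q = 0 -> pt_s q = 1 -> v <= pt_b q by case: H.
have [q1 q1d h1] : exists2 q1, q1 \in d & pt_t q1 = 0 /\ pt_s q1 = 1 /\ pt_b q1 = v.
  have /not_all_in[q1 q1d nq1] : ~ forall q, q \in d ->
    pt_t q = 0 -> pt_s q = 1 -> v < pt_b q.
    by move=> h; apply: nF; split=> //; right.
  by exists q1 => //; have := H _ q1d; have := pt_bound q1; lia.
have [q2 q2d h2] : exists2 q2, q2 \in d & pt_t q2 = 0 /\ pt_s q2 = 0 /\ pt_b q2 = 0.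
  have /not_all_in[q2 q2d nq2] : ~ forall q, q \in d -> pt_b q <> 0.
    by move=> h; apply: nK; constructor 4; constructor 2; exists 0.
  exists q2 => //; have := H _ q2d; have := pt_bound q2.
  by have := hd _ _ q1d q2d; rewrite !leptE; lia.
have h0 : pt_t (mkpt 0 0 v) = 0 /\ pt_s (mkpt 0 0 v) = 0 /\ pt_b (mkpt 0 0 v) = v.
  exact: mkptE.
apply: (fillable_inner (q1 := q2) (q2 := q1)) => //.
all: rewrite ?inE ?q1d ?q2d ?pt_neq ?leptE ?orbT //; lia.
Qed.

(** The sets added here contain [y_0] and [z2_v]. Without the bound on z3,
    already the first of these families would contain [x_0 y_0 z3_0 .. z3_n] and
    [y_0 z3_0 .. z3_n], on which nothing is known yet. *)
Lemma extends_stage_y v : 0 < v <= n -> ext (stage_y v.+1) (stage_y v).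
Proof.
move=> vn; pose q0 := mkpt 0 1 v.
have h0 : pt_t q0 = 0 /\ pt_s q0 = 1 /\ pt_b q0 = v by apply: mkptE; lia.
apply: (@extends_pivot _ _ _ _ _ _ _ _ _ _ q0).
- exact: stage_y_down.
- exact: stage_y_down.
- move=> d [U [k|h|h]]; split=> //; [by constructor 1|by constructor 2|].
  by constructor 3=> q /h; lia.
move=> d hd [U H] nF.
have nK : ~ given true d by move=> k; apply: nF; split=> //; constructor 1.
have /not_all_in[q3 q3d nq3] : ~ forall q, q \in d ->
    pt_t q = 0 -> pt_s q = 1 -> 0 < pt_b q.
  by move=> h; apply: nF; split=> //; constructor 2.
have h3 : pt_t q3 = 0 /\ pt_s q3 = 1 /\ pt_b q3 = 0 by have := pt_bound q3; lia.
have {}H : forall q, q \in d -> (pt_t q = 1 -> pt_s q = 1 -> v <= pt_b q) /\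
                       (pt_t q = 1 -> pt_s q = 2 -> 1 <= pt_b q).
  by case: H => // h; have := h _ q3d; lia.
have [q1 q1d h1] : exists2 q1, q1 \in d & pt_t q1 = 1 /\ pt_s q1 = 1 /\ pt_b q1 = v.
  have /not_all_in[q1 q1d nq1] : ~ forall q, q \in d ->
    (pt_t q = 1 -> pt_s q = 1 -> v < pt_b q) /\
    (pt_t q = 1 -> pt_s q = 2 -> 1 <= pt_b q).
    by move=> h; apply: nF; split=> //; constructor 3.
  by exists q1 => //; have := H _ q1d; have := pt_bound q1; lia.
split.
- apply: chainU1 => // r rd; rewrite !leptE.
  have := H _ rd; have := U _ rd; have := pt_bound r; have := hd _ _ q1d rd.
  by have := hd _ _ q3d rd; rewrite !leptE; lia.
- split=> [r|]; first by rewrite !inE => /orP[/eqP->|/U//]; lia.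
  by constructor 3=> r; rewrite !inE => /orP[/eqP->|/H//]; lia.
- have q1d' : q1 \in d :\ q0 by rewrite !inE q1d pt_neq; lia.
  have q3d' : q3 \in d :\ q0 by rewrite !inE q3d pt_neq; lia.
  case=> _ [k|h|h]; [|by have := h _ q3d'; lia|by have := h _ q1d'; lia].
  apply: nK; apply: (given_setD1 _ q1d' _ q3d' _ q1d' _ q1d') k; try lia.
  by case=> j _ h; have := h _ q1d'; lia.
- apply: (fillable_inner (q1 := q3) (q2 := q1)) => //.
  all: rewrite ?inE ?q1d ?q3d ?pt_neq ?leptE ?orbT //; lia.
Qed.

(** The sets added here contain [y_0] and [z3_v], and [z2_0] unless [v = 0]. For
    [v = 0] the removal of the pivot yields the sets [x_0 y_0 z3_0 .. z3_n] and
    [y_0 z3_0 .. z3_n], which occur in no other pair. *)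
Lemma extends_stage_z2 v : v <= n -> ext (stage_z2 v.+1) (stage_z2 v).
Proof.
move=> vn; pose q0 := mkpt 1 1 v.
have h0 : pt_t q0 = 1 /\ pt_s q0 = 1 /\ pt_b q0 = v by apply: mkptE; lia.
apply: (@extends_pivot _ _ _ _ _ _ _ _ _ _ q0).
- exact: stage_z2_down.
- exact: stage_z2_down.
- move=> d [U [k|h|h|h]]; split=> //;
    [by constructor 1|by constructor 2|by constructor 3|].
  by constructor 4=> q /h; lia.
move=> d hd [U H] nF.
have nK : ~ given true d by move=> k; apply: nF; split=> //; constructor 1.
have /not_all_in[q3 q3d nq3] : ~ forall q, q \in d ->
    pt_t q = 0 -> pt_s q = 1 -> 0 < pt_b q.
  by move=> h; apply: nF; split=> //; constructor 2.
have h3 : pt_t q3 = 0 /\ pt_s q3 = 1 /\ pt_b q3 = 0 by have := pt_bound q3; lia.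
have /not_all_in[q4 q4d nq4] : ~ forall q, q \in d ->
    (pt_t q = 1 -> pt_s q = 1 -> 0 < pt_b q) /\
    (pt_t q = 1 -> pt_s q = 2 -> 0 < pt_b q).
  by move=> h; apply: nF; split=> //; constructor 3.
have {}H : forall q, q \in d -> pt_t q = 1 -> pt_s q = 2 -> v <= pt_b q.
  by case: H => // h; [have := h _ q3d|have := h _ q4d]; lia.
have h4 : pt_t q4 = 1 /\ pt_b q4 = 0 /\ (pt_s q4 = 1 \/ pt_s q4 = 2 /\ v = 0).
  by have := H _ q4d; have := pt_bound q4; lia.
have [q1 q1d h1] : exists2 q1, q1 \in d & pt_t q1 = 1 /\ pt_s q1 = 2 /\ pt_b q1 = v.
  have /not_all_in[q1 q1d nq1] : ~ forall q, q \in d ->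
    pt_t q = 1 -> pt_s q = 2 -> v < pt_b q.
    by move=> h; apply: nF; split=> //; constructor 4.
  by exists q1 => //; have := H _ q1d; have := pt_bound q1; lia.
split.
- apply: chainU1 => // r rd; rewrite !leptE.
  have := H _ rd; have := U _ rd; have := pt_bound r; have := hd _ _ q1d rd.
  by have := hd _ _ q3d rd; have := hd _ _ q4d rd; rewrite !leptE; lia.
- split=> [r|]; first by rewrite !inE => /orP[/eqP->|/U//]; lia.
  by constructor 4=> r; rewrite !inE => /orP[/eqP->|/H//]; lia.
- have q1d' : q1 \in d :\ q0 by rewrite !inE q1d pt_neq; lia.
  have q3d' : q3 \in d :\ q0 by rewrite !inE q3d pt_neq; lia.
  have q4d' : v = 0 \/ q4 \in d :\ q0.
    by have [|v0] := eqVneq v 0; [left|right; rewrite !inE q4d pt_neq; lia].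
  case=> _ [k|h|h|h]; [|by have := h _ q3d'; lia| |by have := h _ q1d'; lia].
    apply: nK; apply: (given_setD1 _ q3d' _ q3d' _ q1d' _ q1d') k; try lia.
    (* a set missing level [j] in z3 misses it everywhere: here [v = 0], and all
       the vertices outside of z3 lie below [q4], hence at level 0 *)
    case=> j hj h; constructor 4; constructor 2; exists j => // r rd.
    have v0 : v = 0 by case: q4d' => // /h; lia.
    have [->|rq] := eqVneq r q0; first by have := h _ q1d'; lia.
    have /h : r \in d :\ q0 by rewrite !inE rq.
    have := h _ q1d'; have := hd _ _ q4d rd; have := pt_bound r.
    by rewrite !leptE; lia.
  by case: q4d' => [v0|/h]; [have := h _ q1d'|]; lia.
- apply: (fillable_inner (q1 := q3) (q2 := q1)) => //.
  all: rewrite ?inE ?q1d ?q3d ?pt_neq ?leptE ?orbT //; lia.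
Qed.

Lemma extends_base_legal : e <= 2 -> ext (base true) legal.
Proof.
move=> e2; apply: (@extends_trans _ _ _ _ _ _ _ _ _ (stage_x true 1)).
  exact: extends_base_stage_x1.
apply: (@extends_trans _ _ _ _ _ _ _ _ _ (stage_y n.+1)).
  apply: extends_iff => d hd _; split=> -[U].
    by case=> h; split=> //; [constructor 1|constructor 2].
  case=> h; split=> //; [by left|by right|].
  have [[q1 q1d h1]|nq1] := pselect (exists2 q1, q1 \in d & pt_t q1 = 1 /\ pt_s q1 = 0).
    right=> q qd; have := hd _ _ q1d qd; have := pt_bound q; rewrite !leptE; lia.
  left; constructor 4; constructor 3; exists 0 => // q qd tq.
  have : ~ pt_s q = 0 by move=> sq; apply: nq1; exists q.
  by have := h _ qd; have := pt_bound q; lia.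
apply: (@extends_trans _ _ _ _ _ _ _ _ _ (stage_y 1)).
  by apply: (@extends_down stage_y) => // v; rewrite ltnS; apply: extends_stage_y.
apply: (@extends_trans _ _ _ _ _ _ _ _ _ (stage_z2 n.+1)).
  apply: extends_iff => d hd _; split=> -[U].
    by case=> h; split=> //; [constructor 1|constructor 2|constructor 3].
  case=> h; split=> //; [by constructor 1|by constructor 2|by constructor 3|].
  constructor 1; constructor 1; split=> // q qd sq.
  by have := h _ qd; have := U _ qd; have := pt_bound q; lia.
apply: (@extends_trans _ _ _ _ _ _ _ _ _ (stage_z2 0)).
  by apply: (@extends_down stage_z2) => // v /andP[_]; rewrite ltnS; apply: extends_stage_z2.
by apply: extends_iff => d _ _; split=> [[]|U] //; split=> //; constructor 4.
Qed.

(** The pivot [(0, 0, 0)] comes first in its simplex, so the horn to be filled is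
    a left outer one; its first edge joins the pivot to [(0, 1, 0)]. *)
Lemma extends_base_all : e = 1 ->
  (forall m (v : cube3 1 e n m.+2), injective (vtx v) ->
     vtx v ord0 = mkpt 0 0 0 -> vtx v (inord 1) = mkpt 0 1 0 ->
     horn_fillable p beta E v ord0) ->
  ext (base false) (fun=> True).
Proof.
move=> e1 fill.
apply: (@extends_trans _ _ _ _ _ _ _ _ _ (stage_x false 1)).
  exact: extends_base_stage_x1.
apply: (@extends_trans _ _ _ _ _ _ _ _ _ (stage_x false 0)); last first.
  apply: extends_iff => d _ _; split=> // _; split; last by right.
  by move=> q _; have := pt_bound q; lia.
apply: extends_stage_x => // d hd [U H] nF.
have nK : ~ given false d by move=> k; apply: nF; split=> //; left.
have [q1 q1d h1] : exists2 q1, q1 \in d & pt_t q1 = 0 /\ pt_s q1 = 1 /\ pt_b q1 = 0.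
  have /not_all_in[q1 q1d nq1] : ~ forall q, q \in d ->
    pt_t q = 0 -> pt_s q = 1 -> 0 < pt_b q.
    by move=> h; apply: nF; split=> //; right.
  by exists q1 => //; have := pt_bound q1; lia.
have [q2 q2d h2] : exists2 q2, q2 \in d & pt_t q2 = 1.
  have /not_all_in[q2 q2d nq2] : ~ forall q, q \in d -> pt_t q = 0.
    by move=> h; apply: nK; constructor 3.
  by exists q2 => //; have := pt_bound q2; lia.
have h0 : pt_t (mkpt 0 0 0) = 0 /\ pt_s (mkpt 0 0 0) = 0 /\ pt_b (mkpt 0 0 0) = 0.
  exact: mkptE.
have h0' : pt_t (mkpt 0 1 0) = 0 /\ pt_s (mkpt 0 1 0) = 1 /\ pt_b (mkpt 0 1 0) = 0.
  exact: mkptE.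
have eq_pt q r : pt_t q = pt_t r -> pt_s q = pt_s r -> pt_b q = pt_b r -> q = r.
  by move=> et es eb; apply/eqP; rewrite -[_ == _]negbK pt_neq et es eb !eqxx.
have eq1 : q1 = mkpt 0 1 0 by apply: eq_pt; lia.
subst q1.
move=> m v k vinj sv vk.
have vtx_in q : q \in mkpt 0 0 0 |: d -> exists i, vtx v i = q.
  by rewrite -sv => /imsetP[i _ ->]; exists i.
have [i1 vi1] : exists i, vtx v i = mkpt 0 1 0 by apply: vtx_in; rewrite !inE q1d orbT.
have [i2 vi2] : exists i, vtx v i = q2 by apply: vtx_in; rewrite !inE q2d orbT.
have lt_vtx i j : lept (vtx v i) (vtx v j) -> vtx v i != vtx v j -> i < j.
  move=> /(vtx_le vinj) ij nij; rewrite ltn_neqAle ij andbT.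
  by apply: contra nij => /eqP/val_inj ->.
have k1 : k < i1 by apply: lt_vtx; rewrite vk vi1 ?leptE ?pt_neq; lia.
have i12 : i1 < i2.
  apply: lt_vtx; rewrite vi1 vi2 ?leptE ?pt_neq; have := pt_bound q2;
    by have := hd _ _ q1d q2d; rewrite !leptE; lia.
have m2 : exists m', m = m'.+2.
  by exists m.-2; have := ltn_ord i2; lia.
case: m2 => m' em; subst m.
have before (i : 'I_m'.+3) : i < i1 -> i = k.
  move=> ii; have ni : vtx v i != mkpt 0 1 0.
    by rewrite -vi1; apply/eqP => /vinj ei; rewrite ei ltnn in ii.
  apply: vinj; rewrite vk.
  have : vtx v i \in mkpt 0 0 0 |: d by rewrite -sv supp_vtx.
  rewrite !inE => /orP[/eqP//|vid]; have := vtx_mono v (ltnW ii).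
  by move: ni; rewrite vi1 leptE pt_neq => *; apply: eq_pt; lia.
have ek : k = ord0 by apply/esym/before/(leq_ltn_trans _ k1).
have ei1 : i1 = inord 1.
  apply/val_inj; rewrite /= inordK //; apply/anti_leq; rewrite (leq_ltn_trans _ k1) // andbT.
  rewrite leqNgt; apply/negP => i1gt.
  have /before/(congr1 val) : (inord 1 : 'I_m'.+3) < i1 by rewrite inordK.
  by rewrite ek /= inordK.
by subst k i1; apply: fill.
Qed.

End Stages.

(** * Simplices of a wide join *)

Section WideJoinElements.
Variables A B : sset.

Lemma wjoin_c_l n (t : Delta 1 n) (a : A n) (b : B n) :
  (forall i, (t : shom n 1) i = ord0) -> wjoin_c A B n ((t, a), b) = wjoin_l A B n a.
Proof.
move=> t0; have bt : boundary_pred t by exists ord_max => i; rewrite t0.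
have := smap_eqP (((exist _ t bt : boundary 1 n, a), b) : wjoin_ends A B n)
  (po_glue (wjoin_proj A B) (wjoin_incl A B)).
by rewrite /= t0 eqxx.
Qed.

Lemma wjoin_c_r n (t : Delta 1 n) (a : A n) (b : B n) :
  (forall i, (t : shom n 1) i = ord_max) -> wjoin_c A B n ((t, a), b) = wjoin_r A B n b.
Proof.
move=> t1; have bt : boundary_pred t by exists ord0 => i; rewrite t1.
have := smap_eqP (((exist _ t bt : boundary 1 n, a), b) : wjoin_ends A B n)
  (po_glue (wjoin_proj A B) (wjoin_incl A B)).
by rewrite /= t1 /=.
Qed.

(** The gluing condition of the pushout only concerns the simplices of the cylinder
    that lie in one of its two ends. *)
Lemma wjoin_desc (Z : sset) (l : smap A Z) (r : smap B Z) (c : smap (wjoin_cyl A B) Z) :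
  (forall n (t : Delta 1 n) a b, (forall i, (t : shom n 1) i = ord0) ->
     c n ((t, a), b) = l n a) ->
  (forall n (t : Delta 1 n) a b, (forall i, (t : shom n 1) i = ord_max) ->
     c n ((t, a), b) = r n b) ->
  exists h : smap (wjoin A B) Z,
    [/\ scomp h (wjoin_l A B) = l, scomp h (wjoin_r A B) = r &
        scomp h (wjoin_c A B) = c].
Proof.
move=> cl cr.
have compat : scomp (scase l r) (wjoin_proj A B) = scomp c (wjoin_incl A B).
  apply: smap_eq => n [[[t bt] a] b] /=.
  have cst i : (t : shom n 1) i = (t : shom n 1) ord0.
    case: bt => j hj; have := hj i; have := hj ord0.
    by move: (t i) (t ord0) j {hj} => [[|[|//]] ?] [[|[|//]] ?] [[|[|//]] ?] h0 hi;
      apply: val_inj => //=; (try by case: h0; apply: val_inj);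
      case: hi; apply: val_inj.
  case: eqVneq => t0; first by rewrite cl // => i; rewrite cst t0.
  rewrite cr // => i; rewrite cst.
  by move: t0; move: (t ord0) => [[|[|//]] ?] // _; apply: val_inj.
exists (po_desc compat); split; last exact: po_desc_inr.
- by apply: smap_eq => n a; apply: (smap_eqP (inl a : scoprod A B n) (po_desc_inl compat)).
- by apply: smap_eq => n b; apply: (smap_eqP (inr b : scoprod A B n) (po_desc_inl compat)).
Qed.

End WideJoinElements.

Lemma scomp_eqP (X Y Y' Z : sset) (f : smap X Y) (g : smap Y Z) (f' : smap X Y')
    (g' : smap Y' Z) n (x : X n) :
  scomp g f = scomp g' f' -> g n (f n x) = g' n (f' n x).
Proof. exact: (@smap_eqP _ _ (scomp g f) (scomp g' f')). Qed.

Section WideJoinMapElements.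
Variables (A A' B B' : sset) (f : smap A A') (g : smap B B') (n : nat).

Lemma wjoin_map_lE (a : A n) :
  wjoin_map f g n (wjoin_l A B n a) = wjoin_l A' B' n (f n a).
Proof. exact: smap_eqP a (wjoin_map_l f g). Qed.

Lemma wjoin_map_rE (b : B n) :
  wjoin_map f g n (wjoin_r A B n b) = wjoin_r A' B' n (g n b).
Proof. exact: smap_eqP b (wjoin_map_r f g). Qed.

Lemma wjoin_map_cE (t : Delta 1 n) (a : A n) (b : B n) :
  wjoin_map f g n (wjoin_c A B n ((t, a), b)) = wjoin_c A' B' n ((t, f n a), g n b).
Proof. exact: (smap_eqP (((t, a), b) : wjoin_cyl A B n) (wjoin_map_c f g)). Qed.

End WideJoinMapElements.

Lemma Delta0_eq n (s s' : Delta 0 n) : s = s'.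
Proof. by apply: shom_eq => i; rewrite (ord1 (s i)) (ord1 (s' i)). Qed.

Definition to_pt n : Delta 0 n := mk_shom (f := fun=> ord0) (fun i j _ => leqnn 0).

Lemma vertex0_eq n (s : Delta 1 n) (k : Delta 0 n) :
  (forall i, (s : shom n 1) i = ord0) -> vertex0 n k = s.
Proof.
move=> s0; apply: shom_eq => i; rewrite s0; apply: val_inj.
by rewrite /= (ord1 (k i)).
Qed.

(** * From cocartesian edges to trivial fibrations *)

Section CocartesianToTrivial.
Variables (X S : sset) (p : smap X S) (u : smap (Delta 1) X) (x : smap (Delta 0) X).
Hypothesis hx : scomp u vertex0 = x.
Hypothesis hp : inner_fibration p.
Hypothesis hu : cocartesian p u.
Variables (n : nat) (al : smap (boundary n) (wslice u)).
Variables (ga : smap (Delta n) (wslice_fiber_product p hx)).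
Hypothesis alga : scomp (wslice_induced p hx) al = scomp ga (boundary_incl n).

Let g := proj1_sig (ga n (shom_id n)).
Let H1 : smap (wjoin (Delta 0) (Delta n)) X := proj1_sig g.1.
Let H2 : smap (wjoin (Delta 1) (Delta n)) S := proj1_sig g.2.

Let H1l : scomp H1 (wjoin_l _ _) = x. Proof. exact: proj2_sig g.1. Qed.
Let H2l : scomp H2 (wjoin_l _ _) = scomp p u. Proof. exact: proj2_sig g.2. Qed.
Let H12 : scomp p H1 = scomp H2 (wjoin_map vertex0 (sid _)).
Proof.
exact: (congr1 (fun z : wslice (scomp p x) n => proj1_sig z)
  (proj2_sig (ga n (shom_id n)))).
Qed.

Let A m (b : boundary n m) : smap (wjoin (Delta 1) (Delta m)) X := proj1_sig (al m b).

Let Al m b : scomp (@A m b) (wjoin_l _ _) = u. Proof. exact: proj2_sig (al m b). Qed.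

Let ga_b m (b : boundary n m) : ga m (proj1_sig b) = act (proj1_sig b) (ga n (shom_id n)).
Proof. exact: yoneda_eq. Qed.

Let A1 m b : scomp (@A m b) (wjoin_map vertex0 (sid _)) =
  scomp H1 (wjoin_map (sid _) (Delta_map (proj1_sig b))).
Proof.
have := smap_eqP b alga; rewrite /= ga_b.
by move=> /(congr1 (fun z => proj1_sig (proj1_sig z).1)).
Qed.

Let A2 m b : scomp p (@A m b) = scomp H2 (wjoin_map (sid _) (Delta_map (proj1_sig b))).
Proof.
have := smap_eqP b alga; rewrite /= ga_b.
by move=> /(congr1 (fun z => proj1_sig (proj1_sig z).2)).
Qed.

Let Aact m l (f : shom l m) b :
  A (act f b) = scomp (@A m b) (wjoin_map (sid _) (Delta_map f)).
Proof. by rewrite /A sfun_act. Qed.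


Let H1lE k z : H1 _ (wjoin_l _ _ k z) = x k z. Proof. exact: smap_eqP z H1l. Qed.
Let H2lE k s : H2 _ (wjoin_l _ _ k s) = p _ (u k s). Proof. exact: smap_eqP s H2l. Qed.

Let H12c k (t : Delta 1 k) (z : Delta 0 k) (b : Delta n k) :
  p _ (H1 _ (wjoin_c _ _ k ((t, z), b))) = H2 _ (wjoin_c _ _ k ((t, vertex0 k z), b)).
Proof.
by have := scomp_eqP (wjoin_c _ _ k ((t, z), b)) H12; rewrite wjoin_map_cE.
Qed.

Let H12r k (b : Delta n k) : p _ (H1 _ (wjoin_r _ _ k b)) = H2 _ (wjoin_r _ _ k b).
Proof. by have := scomp_eqP (wjoin_r _ _ k b) H12; rewrite wjoin_map_rE. Qed.

Let AlE m b k s : @A m b k (wjoin_l _ _ k s) = u k s.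
Proof. exact: smap_eqP s (Al b). Qed.

Let ArE m (b : boundary n m) k (f : Delta m k) :
  A b _ (wjoin_r _ _ k f) =
  H1 _ (wjoin_r _ (Delta n) k (shom_comp (proj1_sig b) f : Delta n k)).
Proof. by have := scomp_eqP (wjoin_r _ _ k f) (A1 b); rewrite !wjoin_map_rE. Qed.

Let A1cE m (b : boundary n m) k (t : Delta 1 k) (z : Delta 0 k) (f : Delta m k) :
  A b _ (wjoin_c _ _ k ((t, vertex0 k z), f)) =
  H1 _ (wjoin_c _ _ k ((t, z), shom_comp (proj1_sig b) f : Delta n k)).
Proof. by have := scomp_eqP (wjoin_c _ _ k ((t, z), f)) (A1 b); rewrite !wjoin_map_cE. Qed.

Let A2cE m (b : boundary n m) k (t s : Delta 1 k) (f : Delta m k) :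
  p _ (A b _ (wjoin_c _ _ k ((t, s), f))) =
  H2 _ (wjoin_c _ _ k ((t, s), shom_comp (proj1_sig b) f : Delta n k)).
Proof. by have := scomp_eqP (wjoin_c _ _ k ((t, s), f)) (A2 b); rewrite !wjoin_map_cE. Qed.

Let Aact_cE m l (f : shom l m) (b : boundary n m) k (t s : Delta 1 k) (h : Delta l k) :
  A (act f b) _ (wjoin_c _ _ k ((t, s), h)) =
  A b _ (wjoin_c _ _ k ((t, s), shom_comp f h : Delta m k)).
Proof. by rewrite Aact -[LHS]/(A b _ (wjoin_map _ _ _ _)) wjoin_map_cE. Qed.

Let V := cube3 1 1 n.
Let beta : smap V S := scomp H2 (wjoin_c _ _).

(* the values forced on a solution by the edge [u], by the right end, by the simplex
   of the slice under [x], and by the boundary of the simplex of the slice under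
   [u] *)
Let R0 m (v : V m) (y : X m) : Prop :=
  (forall i, (v.1.1 : shom m 1) i = ord0) /\ y = u m v.1.2.
Let R1 m (v : V m) (y : X m) : Prop :=
  (forall i, (v.1.1 : shom m 1) i = ord_max) /\ y = H1 _ (wjoin_r _ _ m v.2).
Let Rs m (v : V m) (y : X m) : Prop :=
  (forall i, (v.1.2 : shom m 1) i = ord0) /\
  y = H1 _ (wjoin_c _ _ m ((v.1.1, to_pt m), v.2)).
Let Rb m (v : V m) (y : X m) : Prop := exists hb : boundary_pred (v.2 : Delta n m),
  y = A (exist _ (v.2 : Delta n m) hb : boundary n m) _
    (wjoin_c _ _ m ((v.1.1, v.1.2), shom_id m : Delta m m)).

Definition fat_data m (v : V m) (y : X m) : Prop :=
  [\/ R0 v y, R1 v y, Rs v y | Rb v y].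

Let id_r k l (f : shom k l) : shom_comp f (shom_id k) = f.
Proof. exact: shom_eq. Qed.

Lemma fat_data_plift : plift p beta fat_data.
Proof.
split.
- move=> m l f [[t s] b] y [[h ->]|[h ->]|[h ->]|[h ->]].
  + by constructor 1; split=> [i|]; [apply: h|rewrite sfun_act].
  + by constructor 2; split=> [i|]; [apply: h|rewrite -!sfun_act].
  + constructor 3; split=> [i|]; first exact: h.
    rewrite -!sfun_act; congr (sfun H1 (sfun (wjoin_c _ _) ((_, _), _))); exact: Delta0_eq.
  + constructor 4; exists (boundary_closed f h).
    apply: etrans (esym (Aact_cE f (exist _ (b : Delta n m) h : boundary n m)
      (act f t) (act f s) (shom_id l))); rewrite -!sfun_act.
    by congr (sfun (A _) (sfun (wjoin_c _ _) (_, _))); apply: shom_eq.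
- have f01 m v y y' : @R0 m v y -> R1 v y' -> y = y'.
    by move=> [t0 _] [t1 _]; have := t0 ord0; rewrite t1.
  have f0s m v y y' : @R0 m v y -> Rs v y' -> y = y'.
    case: v => [[t s] b] [t0 ->] [s0 ->].
    by rewrite wjoin_c_l // H1lE -hx -(vertex0_eq (to_pt m) s0).
  have f0b m v y y' : @R0 m v y -> Rb v y' -> y = y'.
    by case: v => [[t s] b] [t0 ->] [hb ->]; rewrite wjoin_c_l // AlE.
  have f1s m v y y' : @R1 m v y -> Rs v y' -> y = y'.
    by case: v => [[t s] b] [t1 ->] [s0 ->]; rewrite wjoin_c_r.
  have f1b m v y y' : @R1 m v y -> Rb v y' -> y = y'.
    by case: v => [[t s] b] [t1 ->] [hb ->]; rewrite wjoin_c_r // ArE id_r.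
  have fsb m v y y' : @Rs m v y -> Rb v y' -> y = y'.
    case: v => [[t s] b] [s0 ->] [hb ->].
    by rewrite -(vertex0_eq (to_pt m) s0) A1cE id_r.
  move=> m v y y' [h|h|h|h] [k|k|k|k];
    try by [exact: f01 h k|exact: f0s h k|exact: f0b h k|exact: f1s h k|
            exact: f1b h k|exact: fsb h k|symmetry; exact: f01 k h|
            symmetry; exact: f0s k h|symmetry; exact: f0b k h|symmetry; exact: f1s k h|
            symmetry; exact: f1b k h|symmetry; exact: fsb k h].
  + by rewrite (proj2 h) (proj2 k).
  + by rewrite (proj2 h) (proj2 k).
  + by rewrite (proj2 h) (proj2 k).
  + by case: h k => [hb ->] [hb' ->]; rewrite (Prop_irrelevance hb hb').
- move=> m [[t s] b] y yG.
  rewrite -[beta _ _]/(H2 m (wjoin_c (Delta 1) (Delta n) m ((t, s), b))).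
  case: yG => [[h ->]|[h ->]|[h ->]|[h ->]].
  + by rewrite wjoin_c_l // H2lE.
  + by rewrite H12r wjoin_c_r.
  + by rewrite H12c (vertex0_eq _ h).
  + by rewrite A2cE id_r.
Qed.

Let supp_all (P : pt 1 1 n -> Prop) m (v : V m) :
  (forall q, q \in supp v -> P q) <-> (forall i, P (vtx v i)).
Proof. by split=> [h i|h _ /imsetP[i _ ->]]; [apply/h/supp_vtx|]. Qed.

Lemma fat_data_dom m (v : V m) : sdom fat_data v <-> base false (supp v).
Proof.
have ord01 (i : 'I_2) : i = ord0 \/ i = ord_max.
  by case: i => [[|[|//]] ?]; [left|right]; apply: val_inj.
split=> [[y yG]|[_ yG]].
  split=> [q _|]; first by have := pt_bound q; lia.
  case: yG => [[h _]|[h _]|[h _]|[[j hj] _]].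
  - by constructor 3; apply/supp_all => i; rewrite /pt_t /= h.
  - by constructor 4; constructor 1; apply/supp_all => i; rewrite /pt_t /= h.
  - by constructor 2; apply/supp_all => i; rewrite /pt_s /= h.
  - constructor 4; constructor 2; exists j; first exact: leq_ord.
    by apply/supp_all => i; rewrite /pt_b /= => /val_inj; apply: hj.
case: yG => [[]//|/supp_all h|/supp_all h|[/supp_all h|[j hj /supp_all h]|[j hj /supp_all h]]].
- exists (H1 m (wjoin_c _ _ m ((v.1.1, to_pt m), v.2 : Delta n m))); constructor 3; split=> // i.
  by have := h i; rewrite /pt_s /=; case: (ord01 ((v.1.2 : shom m 1) i)) => ->.
- exists (u m v.1.2); constructor 1; split=> // i.
  by have := h i; rewrite /pt_t /=; case: (ord01 ((v.1.1 : shom m 1) i)) => ->.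
- exists (H1 m (wjoin_r _ _ m (v.2 : Delta n m))); constructor 2; split=> // i.
  by have := h i; rewrite /pt_t /=; case: (ord01 ((v.1.1 : shom m 1) i)) => ->.
- have hb : boundary_pred (v.2 : Delta n m).
    by exists (inord j) => i e; apply: (h i); rewrite /pt_b /= e inordK.
  exists (A (exist _ (v.2 : Delta n m) hb : boundary n m) m
    (wjoin_c _ _ m ((v.1.1, v.1.2), shom_id m : Delta m m))).
  by constructor 4; exists hb.
- exists (u m v.1.2); constructor 1; split=> // i.
  have := pt_bound (vtx v i); have := h i.
  by rewrite /pt_t /=; case: (ord01 ((v.1.1 : shom m 1) i)) => -> //= []//; lia.
Qed.

(** The first edge of such a simplex lies in the layers x and y, where the data are
    given by [u]. *)
Lemma fat_left_horn m (v : V m.+2) : vtx v ord0 = mkpt 1 n 0 0 0 ->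
  vtx v (inord 1) = mkpt 1 n 0 1 0 -> horn_fillable p beta fat_data v ord0.
Proof.
move=> v0 v1 a ha hab; apply: hu hab _; apply: smap_Delta_eq.
have ini (i : 'I_2) : initial (isT : 1 <= m.+2) i = if i == ord0 then ord0 else inord 1.
  by case: i => [[|[|//]] ?]; apply: val_inj => //=; rewrite inordK.
apply: (ha _ (horn_edge m 1 (shom_id 1))); constructor 1; split=> [i|].
  rewrite -[LHS]/((v.1.1 : shom m.+2 1) (initial (isT : 1 <= m.+2) i)) ini.
  have [e0 e1] := (congr1 (fun q : pt 1 1 n => q.1.1) v0, congr1 (fun q : pt 1 1 n => q.1.1) v1).
  by case: ifP => _; [rewrite -[LHS]/(vtx v ord0).1.1|rewrite -[LHS]/(vtx v (inord 1)).1.1];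
    rewrite ?e0 ?e1; apply: val_inj; rewrite /= inordK.
congr (sfun u _); apply: shom_eq => i.
rewrite -[RHS]/((v.1.2 : shom m.+2 1) (initial (isT : 1 <= m.+2) i)) ini.
have [e0 e1] := (congr1 (fun q : pt 1 1 n => q.1.2) v0, congr1 (fun q : pt 1 1 n => q.1.2) v1).
case: eqVneq => [->|i0].
  by rewrite -[RHS]/(vtx v ord0).1.2 e0; apply: val_inj; rewrite /= inordK.
rewrite -[RHS]/(vtx v (inord 1)).1.2 e1; apply: val_inj; rewrite /= inordK //.
by case: i i0 => [[|[|//]] ?].
Qed.

Lemma fat_filler : exists F : smap V X, scomp p F = beta /\
  forall m (v : V m) y, fat_data v y -> F m v = y.
Proof.
have [|G [hG domG] sub] := extends_base_all (e := 1) (beta := beta) (E := fat_data) isT hp erefl _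
  (conj fat_data_plift fat_data_dom) (fun _ _ _ h => h).
  by move=> m v _; apply: fat_left_horn.
have [F [FG Fb]] := plift_total hG (fun m v => proj2 (domG m v) I).
by exists F; split=> // m v y /sub; apply: (plift_fun hG).
Qed.

Lemma fat_boundary_filler : exists h : smap (Delta n) (wslice u),
  scomp h (boundary_incl n) = al /\ scomp (wslice_induced p hx) h = ga.
Proof.
have [F [Fb FG]] := fat_filler.
have [||H [Hl Hr Hc]] := @wjoin_desc _ _ X u (scomp H1 (wjoin_r _ _)) F.
- by move=> k t s b t0; apply: FG; constructor 1.
- by move=> k t s b t1; apply: FG; constructor 2.
pose h : wslice u n := wslice_mk Hl.
exists (yoneda h); split.
- apply: smap_eq => m b; apply: sig_eq; apply: wjoin_ext.
  + by rewrite [RHS](proj2_sig (al m b)) -[LHS]scompA wjoin_map_l scompA Hl; apply: smap_eq.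
  + rewrite -[LHS]scompA wjoin_map_r scompA Hr; apply: smap_eq => k f.
    by rewrite [RHS]ArE.
  + rewrite -[LHS]scompA wjoin_map_c scompA Hc; apply: smap_eq => k [[t s] f].
    apply: FG; constructor 4.
    exists (boundary_closed (f : shom k m) (proj2_sig b)).
    apply: etrans (esym (Aact_cE (f : shom k m) b t s (shom_id k))).
    by rewrite id_r.
- apply: smap_Delta_eq.
  have -> : scomp (wslice_induced p hx) (yoneda h) n (shom_id n) = wslice_induced p hx n h.
    by rewrite -[LHS]/(wslice_induced p hx n (act (shom_id n) h)) act_id.
  apply: sig_eq; rewrite -[RHS]/g [RHS]surjective_pairing; congr pair.
  + apply: sig_eq; apply: wjoin_ext.
    * by rewrite [RHS]H1l -[LHS]scompA wjoin_map_l scompA Hl.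
    * by rewrite -[LHS]scompA wjoin_map_r scompA Hr; apply: smap_eq.
    * rewrite -[LHS]scompA wjoin_map_c scompA Hc; apply: smap_eq => k [[t z] b].
      apply: FG; constructor 3; split=> [i|].
        by apply: val_inj; rewrite /= (ord1 ((z : shom k 0) i)).
      by rewrite (Delta0_eq (to_pt k) z).
  + apply: sig_eq; apply: wjoin_ext.
    * by rewrite [RHS]H2l -[LHS]scompA Hl.
    * by rewrite -[LHS]scompA Hr; apply: smap_eq => k b; apply: H12r.
    * by rewrite -[LHS]scompA Hc Fb.
Qed.

End CocartesianToTrivial.

(** * The map from the wide join to the ordinary join *)

(** The ends of the cylinder already cover both factors of the join, provided these
    have simplices in the dimension considered. *)
Lemma wjoin_c_onto (A B : sset) n (a0 : A n) (b0 : B n) (z : wjoin A B n) :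
  exists t a b, z = wjoin_c A B n ((t, a), b).
Proof.
pose t0 : Delta 1 n := mk_shom (f := fun=> ord0) (fun i j _ => leqnn 0).
pose t1 : Delta 1 n := mk_shom (f := fun=> ord_max) (fun i j _ => leqnn 1).
rewrite -[z]po_reprK; case: (po_repr z) => [[a|b]|[[t a] b]].
- by exists t0, a, b0; rewrite wjoin_c_l.
- by exists t1, a0, b; rewrite wjoin_c_r.
- by exists t, a, b.
Qed.

Section Crush.
Variables e n : nat.

Definition crush_pt (q : pt 1 e n) : 'I_n.+3 :=
  inord (if pt_t q == 0 then minn (pt_s q) 1 else (pt_b q).+2).

Lemma crush_ptE q :
  crush_pt q = (if pt_t q == 0 then minn (pt_s q) 1 else (pt_b q).+2) :> nat.
Proof. by rewrite inordK //; have := pt_bound q; case: ifP; lia. Qed.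

Lemma crush_mono m (v : cube3 1 e n m) (i j : 'I_m.+1) :
  i <= j -> crush_pt (vtx v i) <= crush_pt (vtx v j).
Proof.
move=> /(vtx_mono v); rewrite leptE !crush_ptE.
by have := pt_bound (vtx v j); have := pt_bound (vtx v i); do 2!case: ifP; lia.
Qed.

Definition crush : smap (cube3 1 e n) (Delta n.+2).
Proof.
exists (fun m (v : cube3 1 e n m) => mk_shom (crush_mono v) : Delta n.+2 m).
by move=> m l f v; apply: shom_eq.
Defined.

Lemma crushE m (v : cube3 1 e n m) i :
  (crush m v : shom m n.+2) i = crush_pt (vtx v i).
Proof. by []. Qed.

(** The missed vertex is 1, 2, 1, [j + 2], [j + 2] for the respective clauses of
    [given]. *)
Lemma crush_base_horn m (v : cube3 1 e n m) : e <= 2 -> base false (supp v) ->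
  horn_pred (ord0 : 'I_n.+3) (crush m v).
Proof.
move=> e2; have ne0 j : 0 < j <= n.+2 -> (inord j : 'I_n.+3) != ord0.
  by move=> hj; rewrite -val_eqE /= inordK; lia.
case=> U [[]//|h|h|[h|[j hj h]|[j hj h]]].
- exists (inord 1); first exact: ne0.
  move=> i /(congr1 val) /=; rewrite crush_ptE inordK //.
  have := h _ (supp_vtx v i); have := U _ (supp_vtx v i).
  by have := pt_bound (vtx v i); case: eqVneq; lia.
- exists (inord 2); first exact: ne0.
  move=> i /(congr1 val) /=; rewrite crush_ptE inordK //.
  by have := h _ (supp_vtx v i); case: eqVneq; lia.
- exists (inord 1); first exact: ne0.
  move=> i /(congr1 val) /=; rewrite crush_ptE inordK //.
  by have := h _ (supp_vtx v i); case: eqVneq; lia.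
- exists (inord j.+2); first exact: ne0.
  move=> i /(congr1 val) /=; rewrite crush_ptE inordK //.
  by have := h _ (supp_vtx v i); case: eqVneq; lia.
- exists (inord j.+2); first exact: ne0.
  move=> i /(congr1 val) /=; rewrite crush_ptE inordK //.
  by have := pt_bound (vtx v i); have := h _ (supp_vtx v i); case: eqVneq; lia.
Qed.

End Crush.

Lemma shift2_mono n (i j : 'I_n.+1) :
  i <= j -> (inord i.+2 : 'I_n.+3) <= (inord j.+2 : 'I_n.+3).
Proof. by move=> ij; have [hi hj] := (leq_ord i, leq_ord j); rewrite !inordK; lia. Qed.

Definition shift2 n : shom n n.+2 := mk_shom (@shift2_mono n).

Lemma crush_wjoin n : exists pi : smap (wjoin (Delta 1) (Delta n)) (Delta n.+2),
  [/\ scomp pi (wjoin_l _ _) = Delta_map (initial (isT : 1 <= n.+2)),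
      scomp pi (wjoin_r _ _) = Delta_map (shift2 n) &
      scomp pi (wjoin_c _ _) = crush 1 n].
Proof.
apply: wjoin_desc => k t s b h; apply: shom_eq => i; apply/val_inj.
  rewrite /= crush_ptE /pt_t /= h eqxx /=; apply/minn_idPl; exact: leq_ord.
by rewrite /= crush_ptE /pt_t /= h /= inordK // !ltnS leq_ord.
Qed.

(** * From trivial fibrations to cocartesian edges *)

Section TrivialToCocartesian.
Variables (X S : sset) (p : smap X S) (u : smap (Delta 1) X) (x : smap (Delta 0) X).
Hypothesis hx : scomp u vertex0 = x.
Hypothesis hp : inner_fibration p.
Variable n : nat.
Hypothesis hphi : rlp (boundary_incl n) (wslice_induced p hx).
Variables (a : smap (horn (ord0 : 'I_n.+3)) X) (b : smap (Delta n.+2) S).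
Hypothesis hab : scomp p a = scomp b (horn_incl ord0).
Hypothesis hau : scomp a (horn_edge n) = u.

Let aE k (s s' : horn (ord0 : 'I_n.+3) k) : proj1_sig s = proj1_sig s' -> a k s = a k s'.
Proof. by move=> es; congr (sfun a _); apply: sig_eq. Qed.

Let paE k (s : horn (ord0 : 'I_n.+3) k) : p k (a k s) = b k (proj1_sig s).
Proof. exact: (scomp_eqP s hab). Qed.

Variable pi : smap (wjoin (Delta 1) (Delta n)) (Delta n.+2).
Hypothesis pil : scomp pi (wjoin_l _ _) = Delta_map (initial (isT : 1 <= n.+2)).
Hypothesis pic : scomp pi (wjoin_c _ _) = crush 1 n.

Section ThroughHorn.
Variables (W : sset) (f : smap W (Delta n.+2)).
Hypothesis hf : forall k w, horn_pred (ord0 : 'I_n.+3) (f k w).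
Definition through_horn : smap W X := scomp a (ssub_corestr (@horn_closed n.+2 ord0) hf).
Lemma through_hornE k (w : W k) (s : horn (ord0 : 'I_n.+3) k) :
  f k w = proj1_sig s -> through_horn k w = a k s.
Proof. by move=> es; rewrite -[LHS]/(a k (exist _ (f k w) (hf w))); apply: aE. Qed.
Lemma through_horn_over : scomp p through_horn = scomp b f.
Proof. by apply: smap_eq => k w; apply: paE. Qed.
End ThroughHorn.

Let through_horn_eq (W W' : sset) (f : smap W (Delta n.+2)) (f' : smap W' (Delta n.+2))
    hf hf' k (w : W k) (w' : W' k) :
  f k w = f' k w' -> @through_horn W f hf k w = @through_horn W' f' hf' k w'.
Proof. by move=> es; apply: through_hornE. Qed.

Let horn0 m (t : Delta 1 m) (z : Delta 0 m) (c : Delta n m) :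
  base false (supp (((t, vertex0 m z), c) : cube3 1 1 n m)).
Proof.
split=> [q _|]; first by have := pt_bound q; lia.
constructor 2 => _ /imsetP[i _ ->].
by rewrite /pt_s /= (ord1 ((z : shom m 0) i)).
Qed.

Let hornb m (t s : Delta 1 m) (c : Delta n m) : boundary_pred c ->
  base false (supp (((t, s), c) : cube3 1 1 n m)).
Proof.
case=> j hj; split=> [q _|]; first by have := pt_bound q; lia.
constructor 4; constructor 2; exists j; first exact: leq_ord.
by move=> _ /imsetP[i _ ->]; rewrite /pt_b /= => /val_inj; apply: hj.
Qed.

Let piE k t s c : pi k (wjoin_c _ _ k ((t, s), c)) = crush 1 n k ((t, s), c).
Proof. exact: (smap_eqP (((t, s), c) : wjoin_cyl (Delta 1) (Delta n) k) pic). Qed.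

Let f1 := scomp pi (wjoin_map vertex0 (sid (Delta n))).

Let f1_horn k w : horn_pred (ord0 : 'I_n.+3) (f1 k w).
Proof.
pose c0 : Delta n k := mk_shom (f := fun=> ord0) (fun i j _ => leqnn 0).
have [t [z [c ->]]] := wjoin_c_onto (to_pt k) c0 w.
rewrite -[f1 _ _]/(pi k (wjoin_map _ _ k _)) wjoin_map_cE piE.
by apply: (crush_base_horn (e := 1)) => //; apply: horn0.
Qed.

Let f1c k t z c : f1 k (wjoin_c _ _ k ((t, z), c)) = crush 1 n k ((t, vertex0 k z), c).
Proof. by rewrite -[LHS]/(pi k (wjoin_map _ _ k _)) wjoin_map_cE piE. Qed.

Let H1 := through_horn f1_horn.

Let H1l : scomp H1 (wjoin_l _ _) = x.
Proof.
rewrite -hx -hau; apply: smap_eq => k z.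
apply: (@through_hornE _ _ f1_horn k _ (horn_edge n k (vertex0 k z))).
rewrite -[LHS]/(pi k (wjoin_map _ _ k _)) wjoin_map_lE.
exact: (smap_eqP (vertex0 k z) pil).
Qed.

Let fb m (c : boundary n m) := scomp pi (wjoin_map (sid (Delta 1)) (Delta_map (proj1_sig c))).

Let fbc m (c : boundary n m) k t s (f : Delta m k) :
  @fb m c k (wjoin_c _ _ k ((t, s), f)) =
  crush 1 n k ((t, s), shom_comp (proj1_sig c) f : Delta n k).
Proof. by rewrite -[LHS]/(pi k (wjoin_map _ _ k _)) wjoin_map_cE piE. Qed.

Let fb_horn m (c : boundary n m) k w : horn_pred (ord0 : 'I_n.+3) (fb c k w).
Proof.
pose t0 : Delta 1 k := mk_shom (f := fun=> ord0) (fun i j _ => leqnn 0).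
pose c0 : Delta m k := mk_shom (f := fun=> ord0) (fun i j _ => leqnn 0).
have [t [z [d ->]]] := wjoin_c_onto t0 c0 w.
rewrite fbc; apply: (crush_base_horn (e := 1)) => //; apply: hornb.
exact: (boundary_closed (d : shom k m) (proj2_sig c)).
Qed.

Let Hb_l m (c : boundary n m) : scomp (through_horn (fb_horn c)) (wjoin_l _ _) = u.
Proof.
rewrite -hau; apply: smap_eq => k z.
apply: (@through_hornE _ _ (fb_horn c) k _ (horn_edge n k z)).
rewrite -[LHS]/(pi k (wjoin_map _ _ k _)) wjoin_map_lE.
exact: (smap_eqP z pil).
Qed.

Let al : smap (boundary n) (wslice u).
Proof.
exists (fun m c => wslice_mk (Hb_l c)) => m l f c; apply: sig_eq.
apply: smap_eq => k w.
apply: (@through_horn_eq _ _ _ _ (fb_horn (act f c)) (fb_horn c)).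
rewrite -[RHS]/(pi k (wjoin_map (sid _) (Delta_map (proj1_sig c)) k
  (wjoin_map (sid (Delta 1)) (Delta_map f) k w))).
rewrite -[LHS]/(pi k (wjoin_map (sid _) (Delta_map (shom_comp (proj1_sig c) f)) k w)).
congr (sfun pi _).
rewrite -[RHS]/(scomp (wjoin_map _ _) (wjoin_map _ _) k w) -wjoin_map_comp.
by apply: smap_eqP; congr wjoin_map; apply: smap_eq => ? ? //; apply: shom_eq.
Defined.

Let h1 : wslice x n := wslice_mk H1l.

Let H2l : scomp (scomp b pi) (wjoin_l _ _) = scomp p u.
Proof. by rewrite -hau scompA hab -!scompA pil; apply: smap_eq. Qed.

Let h2 : wslice (scomp p u) n := wslice_mk H2l.

Let h12 : pullback_pred (wslice_post p x) (wslice_restr (induced_subproof p hx))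
  ((h1, h2) : sprod (wslice x) (wslice (scomp p u)) n).
Proof. by apply: sig_eq; rewrite /= through_horn_over scompA. Qed.

Let ga := yoneda (exist _ _ h12 : wslice_fiber_product p hx n).

Let alga : scomp (wslice_induced p hx) al = scomp ga (boundary_incl n).
Proof.
apply: smap_eq => m c; apply: sig_eq; congr pair; apply: sig_eq.
- apply: smap_eq => k w; apply: (@through_horn_eq _ _ _ _ (fb_horn c) f1_horn).
  rewrite -[RHS]/(pi k (wjoin_map vertex0 (sid _) k
    (wjoin_map (sid _) (Delta_map (proj1_sig c)) k w))).
  rewrite -[LHS]/(pi k (wjoin_map (sid _) (Delta_map (proj1_sig c)) k
    (wjoin_map vertex0 (sid _) k w))).
  rewrite -![wjoin_map _ _ k (wjoin_map _ _ k w)]/(scomp (wjoin_map _ _) (wjoin_map _ _) k w).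
  by rewrite -!wjoin_map_comp; congr (sfun pi _); apply: smap_eqP; congr wjoin_map; apply: smap_eq.
- by rewrite -[LHS]/(scomp p (through_horn _)) through_horn_over /fb scompA.
Qed.

(** The trivial fibration property solves the lifting problem obtained from the
    given horn by pulling back along [pi]. *)
Lemma fat_solution : exists H : smap (wjoin (Delta 1) (Delta n)) X,
  [/\ scomp H (wjoin_l _ _) = u, scomp H (wjoin_map vertex0 (sid _)) = H1,
      forall m (c : boundary n m),
        scomp H (wjoin_map (sid _) (Delta_map (proj1_sig c))) = through_horn (fb_horn c) &
      scomp p H = scomp b pi].
Proof.
have [h [hal hga]] := hphi alga; pose h0 := h n (shom_id n).
have := smap_eqP (shom_id n : Delta n n) hga.
rewrite -[RHS]/(act (shom_id n) (exist _ _ h12 : wslice_fiber_product p hx n)) act_id => e.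
exists (proj1_sig h0); split.
- exact: proj2_sig h0.
- exact: (congr1 (fun z => proj1_sig (proj1_sig z).1) e).
- move=> m c; have := smap_eqP c hal.
  rewrite -[LHS]/(h m (proj1_sig c)) yoneda_eq.
  by move=> /(congr1 (fun z => proj1_sig z)).
- exact: (congr1 (fun z => proj1_sig (proj1_sig z).2) e).
Qed.

Section ThinData.
Variable H : smap (wjoin (Delta 1) (Delta n)) X.
Hypothesis Hl : scomp H (wjoin_l _ _) = u.
Hypothesis Hv : scomp H (wjoin_map vertex0 (sid _)) = H1.
Hypothesis Hb : forall m (c : boundary n m),
  scomp H (wjoin_map (sid _) (Delta_map (proj1_sig c))) = through_horn (fb_horn c).
Hypothesis Hover : scomp p H = scomp b pi.

Let V := cube3 1 2 n.

(* [RE]: the simplices of the wide join, with the values of [H]; [RP]: simplices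
   sent to the horn by [crush], with the values of [a] *)
Let RE m (v : V m) (y : X m) : Prop := exists2 s : Delta 1 m,
  (forall i, (v.1.2 : shom m 2) i = (s : shom m 1) i :> nat) &
  y = H m (wjoin_c _ _ m ((v.1.1, s), v.2)).

Let RP m (v : V m) (y : X m) : Prop := base false (supp v) /\
  exists hs : horn_pred (ord0 : 'I_n.+3) (crush 2 n m v), y = a m (exist _ _ hs).

Definition thin_data m (v : V m) (y : X m) : Prop := RE v y \/ RP v y.

Let beta : smap V S := scomp b (crush 2 n).

Let ord01 (i : 'I_2) : i = ord0 \/ i = ord_max.
Proof. by case: i => [[|[|//]] ?]; [left|right]; apply: val_inj. Qed.

Let crush12 m (v : V m) (s : Delta 1 m) :
  (forall i, (v.1.2 : shom m 2) i = (s : shom m 1) i :> nat) ->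
  crush 1 n m ((v.1.1, s), v.2) = crush 2 n m v.
Proof.
move=> hs; apply: shom_eq => i; apply: val_inj.
by rewrite !crushE /= !crush_ptE /pt_t /pt_s /pt_b /= hs.
Qed.

(* [RE] and [RP] agree where both apply *)
Let H_horn m (t s : Delta 1 m) (c : Delta n m) (z : horn (ord0 : 'I_n.+3) m) :
  [\/ forall i, (s : shom m 1) i = ord0, forall i, (t : shom m 1) i = ord0,
      forall i, (t : shom m 1) i = ord_max | boundary_pred c] ->
  crush 1 n m ((t, s), c) = proj1_sig z ->
  H m (wjoin_c _ _ m ((t, s), c)) = a m z.
Proof.
have Hs0 (s' : Delta 1 m) : (forall i, (s' : shom m 1) i = ord0) ->
    crush 1 n m ((t, s'), c) = proj1_sig z ->
    H m (wjoin_c _ _ m ((t, s'), c)) = a m z.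
  move=> s0; rewrite -(vertex0_eq (to_pt m) s0) => ez.
  rewrite -(wjoin_map_cE vertex0 (sid (Delta n)) t (to_pt m) c).
  rewrite -[LHS]/(scomp H (wjoin_map vertex0 (sid _)) m _) Hv.
  by apply: through_hornE; rewrite f1c.
case=> [s0|t0|t1|hc].
- exact: Hs0.
- rewrite wjoin_c_l // -[X in X = _ -> _]/(crush 1 n m ((t, s), c)) => ez.
  rewrite -[LHS]/(scomp H (wjoin_l _ _) m s) Hl -hau; apply: aE; rewrite -ez.
  rewrite -piE wjoin_c_l //; exact: esym (smap_eqP s pil).
- pose s0 : Delta 1 m := mk_shom (f := fun=> ord0) (fun i j _ => leqnn 0).
  move=> ez; rewrite wjoin_c_r // -(wjoin_c_r s0 c t1); apply: Hs0 => //.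
  by rewrite -ez -!piE !wjoin_c_r.
- move=> ez; pose c' : boundary n m := exist _ c hc.
  have ec : c = shom_comp (proj1_sig c') (shom_id m) :> Delta n m by apply: shom_eq.
  rewrite {1}ec -[shom_comp _ _]/(Delta_map (proj1_sig c') m (shom_id m)).
  rewrite -(wjoin_map_cE (sid (Delta 1)) (Delta_map (proj1_sig c')) t s (shom_id m)).
  rewrite -[LHS]/(scomp H (wjoin_map (sid _) (Delta_map (proj1_sig c'))) m _) Hb.
  by apply: through_hornE; rewrite fbc -ec.
Qed.

Lemma thin_data_plift : plift p beta thin_data.
Proof.
have fEP m v y y' : @RE m v y -> RP v y' -> y = y'.
  case: v => [[t s] c] [s' hs ->] [[U hB] [hh ->]].
  apply: H_horn; last exact: crush12.
  have supp_all (P : pt 1 2 n -> Prop) : (forall q, q \in supp (((t, s), c) : V m) -> P q) ->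
    forall i, P (vtx (((t, s), c) : V m) i) by move=> h i; apply/h/supp_vtx.
  case: hB => [[]//|h|h|[h|[j hj h]|[j hj h]]].
  - constructor 1 => i; have := supp_all _ h i; rewrite /pt_s /= hs.
    by case: (ord01 ((s' : shom m 1) i)) => ->.
  - constructor 2 => i; have := supp_all _ h i; rewrite /pt_t /=.
    by case: (ord01 ((t : shom m 1) i)) => ->.
  - constructor 3 => i; have := supp_all _ h i; rewrite /pt_t /=.
    by case: (ord01 ((t : shom m 1) i)) => ->.
  - constructor 4; exists (inord j) => i e; apply: (supp_all _ h i).
    by rewrite /pt_b /= e inordK.
  - constructor 2 => i; have := supp_all _ h i; rewrite /pt_t /pt_s /= hs.
    case: (ord01 ((t : shom m 1) i)) => -> // /(_ erefl)[].
    by case: (ord01 ((s' : shom m 1) i)) => ->.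
split.
- move=> m l f v y [[s hs ->]|[hB [hh ->]]].
    left; exists (act f s) => [i|]; first exact: hs.
    by rewrite -!sfun_act.
  right; split; first by split; [apply: legal_down (supp_act f v) hB.1|
    apply: given_down (supp_act f v) hB.2].
  have hh' : horn_pred (ord0 : 'I_n.+3) (crush 2 n l (act f v)).
    by rewrite sfun_act; apply: horn_closed.
  by exists hh'; rewrite -sfun_act; apply: aE; apply: shom_eq.
- move=> m v y y' [h|h] [k|k]; [|exact: fEP h k|symmetry; exact: fEP k h|].
    case: h k => [s hs ->] [s' hs' ->]; suff -> : s = s' by [].
    by apply: shom_eq => i; apply: val_inj; apply: etrans (esym (hs i)) (hs' i).
  by case: h k => [_ [hh ->]] [_ [hh' ->]]; apply: aE.
- move=> m v y [[s hs ->]|[hB [hh ->]]].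
    by rewrite (scomp_eqP _ Hover) piE crush12.
  by rewrite paE.
Qed.

Lemma thin_data_dom m (v : V m) : sdom thin_data v <-> base true (supp v).
Proof.
split=> [[y [[s hs _]|[[U hB] _]]]|[U hB]].
- have s2 q : q \in supp v -> pt_s q <> 2.
    case/imsetP => i _ ->; rewrite /pt_s /= hs.
    by have := ltn_ord ((s : shom m 1) i); lia.
  split; last by constructor 1.
  by move=> q /s2; lia.
- by split=> //; case: hB => [[]//|h|h|h]; [constructor 2|constructor 3|constructor 4].
case: hB => [[_ h]|h|h|h].
- have s2 i : (v.1.2 : shom m 2) i <= 1.
    have := h _ (supp_vtx v i); have := pt_bound (vtx v i); rewrite /pt_s /=; lia.
  have sm (i j : 'I_m.+1) : i <= j ->
      (inord ((v.1.2 : shom m 2) i) : 'I_2) <= (inord ((v.1.2 : shom m 2) j) : 'I_2).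
    by move=> ij; rewrite !inordK ?ltnS //; apply: (shom_mono (v.1.2 : shom m 2)).
  exists (H m (wjoin_c _ _ m ((v.1.1, mk_shom sm : Delta 1 m), v.2 : Delta n m))).
  left; exists (mk_shom sm) => [i|]; last by [].
  by rewrite mk_shomE inordK // ltnS.
all: have hB : base false (supp v)
  by split=> //; first [by constructor 2|by constructor 3|by constructor 4].
all: exists (a m (exist _ _ (crush_base_horn (e := 2) isT hB))); right; split=> //; by eexists.
Qed.

(* the vertices of the simplex [x_0 y_0 z3_0 .. z3_n] *)
Let T_pt (i : 'I_n.+3) : pt 1 2 n :=
  mkpt 2 n (1 < i) (if i == 0 :> nat then 0 else if i == 1 :> nat then 1 else 2) (i - 2).

Let T_ptE i : pt_t (T_pt i) = (1 < i) /\ pt_b (T_pt i) = i - 2 /\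
  (i = 0 :> nat -> pt_s (T_pt i) = 0) /\ (i = 1 :> nat -> pt_s (T_pt i) = 1) /\
  (1 < i -> pt_s (T_pt i) = 2).
Proof.
have [||| -> [-> ->]] := @mkptE 2 n (1 < i)
  (if i == 0 :> nat then 0 else if i == 1 :> nat then 1 else 2) (i - 2).
- by case: (1 < i).
- by case: (i == 0 :> nat) => //; case: (i == 1 :> nat).
- by have := leq_ord i; lia.
by case: (i : nat) => [|[|k]].
Qed.

Lemma thin_filler :
  exists h : smap (Delta n.+2) X, scomp h (horn_incl ord0) = a /\ scomp p h = b.
Proof.
have [G [hG domG] sub] := extends_base_legal (e := 2) (beta := beta) (E := thin_data)
  isT hp isT (conj thin_data_plift thin_data_dom) (fun _ _ _ h => h).
have [|T hT] := @vtx_surj 1 2 n n.+2 T_pt.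
  move=> i j ij; rewrite leptE; have := T_ptE i; have := T_ptE j.
  by lia.
have crT : crush 2 n n.+2 T = shom_id n.+2.
  apply: shom_eq => i; apply: val_inj; rewrite /= crush_ptE hT.
  by have := T_ptE i; case: eqVneq; lia.
have lT : legal (supp T).
  move=> _ /imsetP[i _ ->]; rewrite hT; have := T_ptE i.
  by lia.
have [xT TxT] : sdom G T by apply/domG.
exists (yoneda xT); split; last first.
  apply: smap_Delta_eq; rewrite -[LHS]/(p n.+2 (act (shom_id n.+2) xT)) act_id.
  by rewrite (plift_over hG TxT) -[LHS]/(b n.+2 (crush 2 n n.+2 T)) crT.
apply: smap_eq => m f; rewrite -[LHS]/(act (proj1_sig f) xT).
have hact := plift_act hG (proj1_sig f) TxT.
have vE i : vtx (act (proj1_sig f) T) i = T_pt ((proj1_sig f : shom m n.+2) i) by rewrite -hT.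
have hB : base false (supp (act (proj1_sig f) T)).
  split; first exact: legal_down (supp_act _ _) lT.
  have [j j0 hj] := proj2_sig f.
  have fj i : (proj1_sig f : shom m n.+2) i <> j :> nat by move=> /val_inj; apply: hj.
  have [j1|j1] := eqVneq (j : nat) 1.
    constructor 2 => _ /imsetP[i _ ->]; rewrite vE => e.
    by have := fj i; have := T_ptE ((proj1_sig f : shom m n.+2) i); lia.
  constructor 4; constructor 3; exists (j - 2); first by have := leq_ord j; lia.
  move=> _ /imsetP[i _ ->]; rewrite vE => e.
  move: e (fj i) j0; have := T_ptE ((proj1_sig f : shom m n.+2) i).
  by rewrite -val_eqE /=; lia.
apply: (plift_fun hG hact); apply: sub; right; split=> //.
exists (crush_base_horn (e := 2) isT hB); apply: aE.
have := sfun_act (crush 2 n) (proj1_sig f : shom m n.+2) T; rewrite crT => e.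
by apply: etrans (esym e); apply: shom_eq.
Qed.

End ThinData.

End TrivialToCocartesian.

Lemma boundary_incl_mono n : monomorphism (boundary_incl n).
Proof.
move=> W f g e; apply: smap_eq => m w; apply: sig_eq.
exact: (smap_eqP w e).
Qed.

(** * The theorem *)

Theorem theorem1p4 (X S : sset) (p : smap X S) (hp : inner_fibration p)
    (x y : smap (Delta 0) X) (u : smap (Delta 1) X)
    (hx : scomp u vertex0 = x) (hy : scomp u vertex1 = y) :
  cocartesian p u <-> trivial_kan_fibration (wslice_induced p hx).
Proof.
split=> [hu|htriv].
  apply: trivial_kan_of_boundary => n al ga alga.
  exact (fat_boundary_filler hp hu alga).
move=> n a b hab hau; have [pi [pil _ pic]] := crush_wjoin n.
have hphi : rlp (boundary_incl n) (wslice_induced p hx).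
  exact/htriv/boundary_incl_mono.
have [H [Hl Hv Hb Ho]] := fat_solution hphi hab hau pil pic.
exact (thin_filler hp hab hau pil Hl Hv Hb Ho).
Qed.
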